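(* Let $B=2^{k_1}C_1\perp\cdots\perp2^{k_r}C_r\in\mathcal H_n(\mathfrak o)$ be a pre-optimal form, let $B_1=2^{k_1}C_1\perp\cdots\perp2^{k_{r-1}}C_{r-1}$, $n_1=\deg B_1$, $\mathrm{GK}(B)=(a_1,\dots,a_n)$, and put $m=k_r$ if $C_r$ is unimodular diagonal and $m=k_r-2$ otherwise. Suppose that (1) there are integers $b_{n_1+1},\ldots,b_n$ with $(\mathrm{GK}(B_1),b_{n_1+1},\ldots,b_n)\in\mathbf S(\{B\})$, and (2) $a_{n_1+1}\le m+2$. Then there is an optimal basis $\{u_i\}_{1\le i\le n}$ of $L_B$ such that $\{u_i\}_{1\le i\le n_1}$ is an optimal basis of $L_{B_1}$.
   Context: Let $F$ be a finite unramified extension of $\mathbb Q_2$ with ring of integers $\mathfrak o$, $\mathrm{ord}$ the valuation with $\mathrm{ord}(2)=1$, $\mathrm{ord}(0)=+\infty$. $\mathcal H_n(\mathfrak o)$ is the set of symmetric $B=(b_{ij})\in M_n(F)$ with $b_{ii}\in\mathfrak o$, $2b_{ij}\in\mathfrak o$. $\perp$ is block-diagonal sum. For nondegenerate $B$ of degree $n$: $D_B=(-4)^{[n/2]}\det B$; $\xi_B=1,-1,0$ according as $D_B\in F^{\times2}$, $F(\sqrt{D_B})/F$ unramified quadratic, or ramified. $S_2(\mathfrak o)_e$: symmetric $2\times2$ matrices over $\mathfrak o$ with diagonal in $2\mathfrak o$; unimodular diagonal: diagonal with unit entries. GK invariant: $S(B)$ = set of non-decreasing $(a_i)\in\mathbb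 Z_{\ge0}^n$ with $\mathrm{ord}(b_{ii})\ge a_i$, $\mathrm{ord}(2b_{ij})\ge(a_i+a_j)/2$ ($1\le i\le j\le n$); $\mathbf S(\{B\})=\bigcup_{U\in GL_n(\mathfrak o)}S({}^tUBU)$; $\mathrm{GK}(B)$ its lexicographically greatest element; $B$ is optimal if $\mathrm{GK}(B)\in S(B)$. Quadratic modules: for $B\in\mathcal H_n(\mathfrak o)$, $L_B$ is a free $\mathfrak o$-module with basis $\psi_1,\dots,\psi_n$ and quadratic form $Q$ whose bilinear form $(x,y)=Q(x+y)-Q(x)-Q(y)$ satisfies $\frac12(\psi_i,\psi_j)=b_{ij}$. A basis $u_1,\dots,u_n$ of $L_B$ is optimal if the matrix $(\frac12(u_i,u_j))_{i,j}$ is optimal. When $B=B_1\perp B_2$ with $\deg B_1=n_1$, $L_{B_1}$ is identified with the submodule spanned by $\psi_1,\dots,\psi_{n_1}$ with the restricted form. Pre-optimal forms: $B=2^{k_1}C_1\perp\cdots\perp2^{k_r}C_r$ with $k_i\ge0$, each $C_i$ unimodular diagonal or in $\frac12(S_2(\mathfrak o)_e\cap GL_2(\mathfrak o))$; $B^{[j]}=2^{k_1}C_1\perp\cdots\perp2^{k_j}C_j$; $\mathcal D_m=\{j:k_j=m,C_j\text{ diagonal}\}$, $\mathcal E_m=\{j:k_j=m,C_j\text{ not diagonal}\}$. Pre-optimal means: (PO1) $\sum_{j\in\mathcal D_m}\deg C_j\le2$ and $\mathcal E_m$ is a (possibly empty) set of consecutive integers, for each $m$; (PO2) for $i<j$: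 $i\in\mathcal D_{m_1},j\in\mathcal D_{m_2}\Rightarrow m_1\le m_2$; $i\in\mathcal E_{m_1},j\in\mathcal E_{m_2}\Rightarrow m_1\le m_2$; $i\in\mathcal D_{m_1},j\in\mathcal E_{m_2}\Rightarrow m_1\le m_2-1$; $i\in\mathcal E_{m_1},j\in\mathcal D_{m_2}\Rightarrow m_1\le m_2+1$; (PO3) if $C_i$ is unimodular diagonal of degree 2 then $i\ge2$ and either ($\deg B^{[i]}$ even and $\xi_{B^{[i-1]}}=\xi_{B^{[i]}}=0$) or ($\deg B^{[i-1]}$ odd and $\mathrm{ord}\det B^{[i-1]}+k_i$ even); (PO4) if $k_i=k_{i-1}-1$, $C_i$ diagonal, $C_{i-1}$ not diagonal, then $\deg C_i=2$, or $\deg C_i=1$ and either ($\deg B^{[i]}$ and $\mathrm{ord}\det B^{[i]}$ even) or ($\deg B^{[i]}$ odd and $\xi_{B^{[i-1]}}=0$); (PO5) if $C_i$ diagonal, $C_{i+1}$ not diagonal, $k_i=k_{i+1}-1$, then $\deg C_i=1$ and either ($\deg B^{[i]}$ even and $\mathrm{ord}\det B^{[i]}$ odd) or ($\deg B^{[i]}$ odd and $\xi_{B^{[i-1]}}\ne0$ if $i\ge2$); (PO6) if $\deg B^{[i]}$ even, $C_i,C_{i+1}$ unimodular diagonal, $k_{i+1}=k_i+1$, then $\xi_{B^{[i]}}=0$. *)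

(* Defs.v *)
From HB Require Import structures.
From mathcomp Require Import all_boot all_order all_algebra.
From Stdlib Require Import ClassicalEpsilon.
Set Implicit Arguments. Unset Strict Implicit. Unset Printing Implicit Defensive.
Import Order.TTheory GRing.Theory Num.Theory.
Local Open Scope ring_scope.

(* The base field.  F is a field with a discrete valuation v : F -> int     *)
(* (meaningful on F^x; ord(0) = +oo is handled by [geord]).                 *)
(* [unram_ext_Q2 v] says: v is a valuation with v(2) = 1, F is complete,    *)
(* and the residue field is finite.  Such (F, v) are exactly the finite     *)
(* unramified extensions of Q_2 (v(2)=1 forces char 0 and e = 1).           *)

Section Defs.
Variables (F : fieldType) (v : F -> int).

Definition geord (x : F) (k : int) : bool := (x == 0) || (k <= v x).
Definition in_o (x : F) : Prop := geord x 0.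
Definition unit_o (x : F) : Prop := x != 0 /\ v x = 0.

Definition unram_ext_Q2 : Prop :=
  [/\ (forall x y, x != 0 -> y != 0 -> v (x * y) = v x + v y),
      (forall x y, x != 0 -> y != 0 -> x + y != 0 ->
          Num.min (v x) (v y) <= v (x + y)),
      (2%:R : F) != 0 /\ v 2%:R = 1,
      (exists s : seq F, (forall y, y \in s -> in_o y) /\
          forall x, in_o x -> exists2 y, y \in s & geord (x - y) 1) &
      (forall x : nat -> F,
         (forall k : int, exists N, forall p q, (N <= p)%N -> (N <= q)%N ->
             geord (x p - x q) k) ->
         exists l, forall k : int, exists N, forall p, (N <= p)%N ->
             geord (x p - l) k)].

Definition inGLo n (U : 'M[F]_n) : Prop :=
  (forall i j, in_o (U i j)) /\ unit_o (\det U).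

Definition inH n (B : 'M[F]_n) : Prop :=
  B^T = B /\ (forall i, in_o (B i i)) /\ (forall i j, in_o (2%:R * B i j)).

Definition inS n (B : 'M[F]_n) (s : seq nat) : Prop :=
  size s = n /\ sorted leq s /\
  forall i j : 'I_n, (i <= j)%N ->
     geord (B i i) (nth 0%N s i)%:Z /\
     ((2%:R * B i j) == 0 \/
        ((nth 0%N s i)%:Z + (nth 0%N s j)%:Z <= 2%:Z * v (2%:R * B i j))).

Definition SS n (B : 'M[F]_n) (s : seq nat) : Prop :=
  exists U : 'M[F]_n, inGLo U /\ inS (U^T *m B *m U) s.

(* lexicographic order on sequences of nat (of equal length) *)
Fixpoint lexle (s t : seq nat) : bool :=
  match s, t with
  | x :: s', y :: t' => (x < y)%N || ((x == y) && lexle s' t')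
  | _, _ => true
  end.

Definition isGK n (B : 'M[F]_n) (a : seq nat) : Prop :=
  SS B a /\ forall t, SS B t -> lexle t a.

Definition optimal n (B : 'M[F]_n) : Prop :=
  exists a, isGK B a /\ inS B a.

Definition DB n (B : 'M[F]_n) : F := (- 4%:R) ^+ (n./2) * \det B.

(* xi_B = 1 if D_B is a nonzero square; -1 if F(sqrt D_B)/F is the unramified
   quadratic extension, i.e. D_B is a non-square in (1 + 4o) F^x2; 0 otherwise
   (ramified). *)
Definition xi n (B : 'M[F]_n) : int :=
  let D := DB B in
  if excluded_middle_informative (exists y : F, y != 0 /\ D = y ^+ 2) then 1
  else if excluded_middle_informative
      (exists w y : F, in_o w /\ y != 0 /\ D = (1 + 4%:R * w) * y ^+ 2)
  then -1 else 0.

End Defs.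

(* Blocks of a pre-optimal form.                                            *)
(*   Dg k us     = 2^k * diag(us)          (unimodular diagonal C)          *)
(*   Nd k a b c  = 2^k * [[a, b/2],[b/2, c]] (C in 1/2(S_2(o)_e cap GL_2(o)))*)

Inductive blk (F : Type) :=
  | Dg of nat & seq F
  | Nd of nat & F & F & F.

Section Blocks.
Variables (F : fieldType) (v : F -> int).

Definition bk (b : blk F) : nat := match b with Dg k _ => k | Nd k _ _ _ => k end.
Definition bisdiag (b : blk F) : bool := match b with Dg _ _ => true | _ => false end.
Definition bdeg (b : blk F) : nat := match b with Dg _ us => size us | Nd _ _ _ _ => 2 end.

Definition wf_blk (b : blk F) : Prop :=
  match b with
  | Dg _ us => us != [::] /\ forall u, u \in us -> unit_o v u
  | Nd _ a b c => in_o v a /\ in_o v b /\ in_o v c /\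
                  unit_o v (4%:R * a * c - b ^+ 2)
  end.

Definition blkent (b : blk F) (i j : nat) : F :=
  match b with
  | Dg k us => if i == j then 2%:R ^+ k * nth 0 us i else 0
  | Nd k a b c => 2%:R ^+ k *
      (if (i == 0%N) && (j == 0%N) then a
       else if (i == 1%N) && (j == 1%N) then c else b / 2%:R)
  end.

Fixpoint bfun (bs : seq (blk F)) (i j : nat) : F :=
  match bs with
  | [::] => 0
  | b :: bs' =>
      let d := bdeg b in
      if (i < d)%N then (if (j < d)%N then blkent b i j else 0)
      else if (j < d)%N then 0 else bfun bs' (i - d) (j - d)
  end.

Definition bsdeg (bs : seq (blk F)) : nat := sumn (map bdeg bs).

Definition bmx (bs : seq (blk F)) : 'M[F]_(bsdeg bs) :=
  \matrix_(i, j) bfun bs i j.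

(* 1-based access *)
Definition blk0 : blk F := Dg 0 [::].
Definition bat (bs : seq (blk F)) (i : nat) : blk F := nth blk0 bs i.-1.
Definition kk bs i := bk (bat bs i).
Definition isD bs i := bisdiag (bat bs i).
Definition dC bs i := bdeg (bat bs i).
Definition Bpre (bs : seq (blk F)) (j : nat) := bmx (take j bs).
Definition degpre bs j := bsdeg (take j bs).
Definition orddetpre bs j : int := v (\det (Bpre bs j)).
Definition xipre bs j : int := xi v (Bpre bs j).

Definition preoptimal (bs : seq (blk F)) : Prop :=
  let r := size bs in
  let idx i := (1 <= i <= r)%N in
  (forall m : nat,
     (\sum_(1 <= j < r.+1 | isD bs j && (kk bs j == m)) dC bs j <= 2)%N /\
     (forall i j l, idx i -> idx l -> (i < j < l)%N ->
        ~~ isD bs i -> kk bs i = m -> ~~ isD bs l -> kk bs l = m ->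
        ~~ isD bs j /\ kk bs j = m)) /\
  (forall i j, idx i -> idx j -> (i < j)%N ->
     [/\ (isD bs i -> isD bs j -> (kk bs i <= kk bs j)%N),
         (~~ isD bs i -> ~~ isD bs j -> (kk bs i <= kk bs j)%N),
         (isD bs i -> ~~ isD bs j -> (kk bs i + 1 <= kk bs j)%N) &
         (~~ isD bs i -> isD bs j -> (kk bs i <= kk bs j + 1)%N)]) /\
  (forall i, idx i -> isD bs i -> dC bs i = 2%N ->
     (2 <= i)%N /\
     ((~~ odd (degpre bs i) /\ xipre bs i.-1 = 0 /\ xipre bs i = 0) \/
      (odd (degpre bs i.-1) /\ ~~ odd (absz (orddetpre bs i.-1 + (kk bs i)%:Z))))) /\
  (forall i, (2 <= i <= r)%N ->
     kk bs i + 1 = kk bs i.-1 -> isD bs i -> ~~ isD bs i.-1 ->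
     dC bs i = 2%N \/
     (dC bs i = 1%N /\
      ((~~ odd (degpre bs i) /\ ~~ odd (absz (orddetpre bs i))) \/
       (odd (degpre bs i) /\ xipre bs i.-1 = 0)))) /\
  (forall i, (1 <= i < r)%N ->
     isD bs i -> ~~ isD bs i.+1 -> kk bs i + 1 = kk bs i.+1 ->
     dC bs i = 1%N /\
     ((~~ odd (degpre bs i) /\ odd (absz (orddetpre bs i))) \/
      (odd (degpre bs i) /\ ((2 <= i)%N -> xipre bs i.-1 != 0)))) /\
  (forall i, (1 <= i < r)%N ->
     ~~ odd (degpre bs i) -> isD bs i -> isD bs i.+1 ->
     kk bs i.+1 = (kk bs i).+1 -> xipre bs i = 0).

End Blocks.

Definition ent (R : nmodType) n (M : 'M[R]_n) (i j : nat) : R :=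
  match (insub i : option 'I_n), (insub j : option 'I_n) with
  | Some i', Some j' => M i' j'
  | _, _ => 0
  end.

Definition topleft (R : nmodType) n1 n (M : 'M[R]_n) : 'M[R]_n1 :=
  \matrix_(i < n1, j < n1) ent M i j.

(* Main.v *)
Require Import Defs.
From mathcomp Require Import all_boot all_order all_algebra.
From mathcomp Require Import fingroup perm zify ring.
Set Implicit Arguments. Unset Strict Implicit. Unset Printing Implicit Defensive.
Import Order.TTheory GRing.Theory Num.Theory.
Local Open Scope ring_scope.

(* Write [L_B = L_1 + L_2], where [L_2] carries the last block [2^k C], and start from an optimal
   basis [w] of [L_B] with exponents [a].  Choose pivots in [w], as far to the right as possible,
   whose [L_2]-components form a basis of [L_2], and subtract multiples of them from the other [w_j]
   whenever the exponents allow it; what is left of the [L_2]-component of [w_j] lies in [2 L_2].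
   Projecting to [L_1] gives a basis of [L_1] whose exponents are those of the [w_j] truncated at
   [k + 2].  By the lexicographic maximality of [GK(B_1)] and hypothesis (1) these are exactly the
   entries of [GK(B_1)], which is therefore the beginning of [GK(B)].  If no truncation took place,
   every [w_j] has been moved into [L_1] and the basis is the required one.  A truncation can occur
   only for a diagonal [C], and then yields two independent vectors in the radical of the form
   induced on the graded pieces of [L_1]; as the residue field is perfect, some combination of them
   is singular, which contradicts the maximality of [GK(B_1)]. *)

(** * Orders of elements of [F] and square roots modulo 2 *)

Section Valuation.
Variables (F : fieldType) (v : F -> int).
Hypothesis Hv : unram_ext_Q2 v.

(* Bounds on [2 * v x] rather than on [v x]: the exponents [(a_i + a_j) / 2] need not be integers. *)
Definition hord (x : F) (k : int) : bool := (x == 0) || (k <= 2 * v x).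

Lemma ord_vM (x y : F) : x != 0 -> y != 0 -> v (x * y) = v x + v y.
Proof. by case: Hv => h _ _ _ _; apply: h. Qed.

Lemma ord_vD (x y : F) : x != 0 -> y != 0 -> x + y != 0 -> (v x <= v (x + y)) || (v y <= v (x + y)).
Proof. by case: Hv => _ h _ _ _ x0 y0 s0; rewrite -ge_min; exact: h. Qed.

Lemma ord_v1 : v 1 = 0.
Proof.
have := ord_vM (oner_neq0 F) (oner_neq0 F); rewrite mulr1; move: (v 1) => x; lia.
Qed.

Lemma ord_vV x : x != 0 -> v x^-1 = - v x.
Proof.
move=> x0; have := @ord_vM x x^-1 x0; rewrite invr_eq0 divff // ord_v1 => /(_ x0); lia.
Qed.

Lemma ord_vN x : v (- x) = v x.
Proof.
case: (eqVneq x 0) => [->|x0]; first by rewrite oppr0.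
have m1 : (-1 : F) != 0 by rewrite oppr_eq0 oner_eq0.
have := ord_vM m1 m1; rewrite mulrNN mulr1 ord_v1 => e.
by rewrite -mulN1r ord_vM //; lia.
Qed.

Lemma two_neq0 : (2%:R : F) != 0.
Proof. by case: Hv => _ _ [h h'] _ _. Qed.

Lemma ord_v2 : v 2%:R = 1.
Proof. by case: Hv => _ _ [h h'] _ _. Qed.

Lemma hordE x k : geord v x k = hord x (2 * k).
Proof. rewrite /geord /hord; case: eqP => //= _; lia. Qed.

Lemma hord_le x k l : l <= k -> hord x k -> hord x l.
Proof. rewrite /hord; case: eqP => //= _; lia. Qed.

Lemma hord0 k : hord 0 k.
Proof. by rewrite /hord eqxx. Qed.

Lemma hordN x k : hord (- x) k = hord x k.
Proof. by rewrite /hord oppr_eq0 ord_vN. Qed.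

Lemma hordD x y k : hord x k -> hord y k -> hord (x + y) k.
Proof.
rewrite /hord; case: (eqVneq x 0) => [->|x0]; first by rewrite add0r.
case: (eqVneq y 0) => [->|y0]; first by rewrite addr0 (negbTE x0).
case: (eqVneq (x + y) 0) => //= s0.
have /orP[] := ord_vD x0 y0 s0; lia.
Qed.

Lemma hordB x y k : hord x k -> hord y k -> hord (x - y) k.
Proof. by move=> hx hy; rewrite hordD ?hordN. Qed.

Lemma hordM x y k l : hord x k -> hord y l -> hord (x * y) (k + l).
Proof.
rewrite /hord mulf_eq0; case: (eqVneq x 0) => //= x0.
case: (eqVneq y 0) => //= y0; rewrite ord_vM //; lia.
Qed.

Lemma hordMo x y k : hord x k -> hord y 0 -> hord (x * y) k.
Proof. by move=> hx hy; rewrite -[k]addr0 hordM. Qed.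

Lemma hord_oM x y k : hord x 0 -> hord y k -> hord (x * y) k.
Proof. by move=> hx hy; rewrite mulrC hordMo. Qed.

Lemma hord_sum (I : Type) (r : seq I) (P : pred I) (f : I -> F) k :
  (forall i, P i -> hord (f i) k) -> hord (\sum_(i <- r | P i) f i) k.
Proof.
by move=> H; elim/big_ind: _ => //; [exact: hord0 | move=> x y; exact: hordD].
Qed.

Lemma hord2 : hord 2%:R 2.
Proof. by rewrite /hord ord_v2 orbT. Qed.

Lemma hord1 : hord 1 0.
Proof. by rewrite /hord ord_v1 orbT. Qed.

Lemma hordX x n : hord x 0 -> hord (x ^+ n) 0.
Proof.
by move=> hx; elim: n => [|n IH]; rewrite ?hord1 // exprS hordMo.
Qed.

Lemma unitoE x : unit_o v x <-> hord x 0 /\ ~~ hord x 2.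
Proof.
rewrite /unit_o /hord; case: (eqVneq x 0) => [_|x0] /=; first by split=> -[].
by split=> [[_ ->]|[h1 h2]]; [|split=> //; lia].
Qed.

Lemma unito_hordV x : unit_o v x -> hord x^-1 0.
Proof. by move=> [x0 vx]; rewrite /hord ord_vV // vx orbT. Qed.

Lemma unito_mulr x y : hord x 0 -> hord y 0 -> unit_o v (x * y) -> unit_o v x.
Proof.
move=> hx hy /unitoE [_ /negP h]; apply/unitoE; split => //; apply/negP => hx2.
by apply: h; rewrite hordMo.
Qed.

(* The powers [u ^ (2 ^ i)] cannot all be distinct in the finite residue field,
   where squaring is injective, so [u] is congruent to one of them with [i > 0]. *)
Lemma sqrt_mod2 u : hord u 0 -> exists2 s, hord s 0 & hord (s ^+ 2 - u) 2.
Proof.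
move=> hu; case: Hv => _ _ _ [S [_ HS]] _.
pose f (i : nat) := find (fun y => geord v (u ^+ (2 ^ i) - y) 1) S.
have fS i : (f i < size S)%N.
  rewrite -has_find; have [|y yS yg] := HS (u ^+ (2 ^ i)).
    by rewrite /in_o hordE hordX.
  by apply/hasP; exists y.
have fP i : hord (u ^+ (2 ^ i) - nth 0 S (f i)) 2.
  have := nth_find 0 (a := fun y => geord v (u ^+ (2 ^ i) - y) 1) (s := S).
  by rewrite has_find => /(_ (fS i)); rewrite hordE.
(* Squaring is injective modulo 2: [(x - y)^2] and [x^2 - y^2] differ by twice an integral
   element. *)
have hinj (x y : F) : hord x 0 -> hord y 0 -> hord (x ^+ 2 - y ^+ 2) 2 -> hord (x - y) 2.
  move=> hx hy hxy; have : hord ((x - y) * (x - y)) 2.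
    have -> : (x - y) * (x - y) = (x ^+ 2 - y ^+ 2) - 2%:R * (y * (x - y)) by ring.
    by rewrite hordB // hordMo ?hord2 // hordMo // hordB.
  rewrite /hord mulf_eq0 orbb; case: (eqVneq (x - y) 0) => //= d0.
  rewrite ord_vM //; lia.
have : ~~ injectiveb (fun i : 'I_(size S).+1 => Ordinal (fS i)).
  apply/negP => /injectiveP/leq_card; rewrite !card_ord; lia.
case/injectivePn => i [j ij [eqf]].
wlog lt : i j ij eqf / (i < j)%N.
  move=> H; case: (ltngtP i j) => [|/(H j i)|/val_inj e]; [exact: H| |].
    by rewrite eq_sym; apply.
  by rewrite e eqxx in ij.
have {eqf} : hord (u ^+ (2 ^ i) - u ^+ (2 ^ j)) 2.
  have -> : u ^+ (2 ^ i) - u ^+ (2 ^ j) =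
    (u ^+ (2 ^ i) - nth 0 S (f i)) - (u ^+ (2 ^ j) - nth 0 S (f j)).
    by rewrite eqf; ring.
  exact: hordB.
(* Cancelling [i] squarings leaves a congruence between [u] and [u^(2^(l+1))], the square of
   [u^(2^l)]. *)
have -> : nat_of_ord j = (i + (j - i.+1).+1)%N by lia.
move: (j - i.+1)%N => l; elim: (nat_of_ord i) => [|p IH].
  rewrite expn0 expr1 add0n expnS mulnC exprM => h.
  by exists (u ^+ (2 ^ l)); [exact: hordX | rewrite -hordN opprB].
rewrite addSn !expnS ![(2 * _)%N]mulnC !exprM => h; apply: IH.
by apply: hinj; rewrite // hordX.
Qed.

(** * Integral matrices and [GL_n(o)] *)

Definition omx m n (A : 'M[F]_(m, n)) : Prop := forall i j, hord (A i j) 0.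

Lemma inGLoE n (U : 'M[F]_n) : inGLo v U <-> omx U /\ unit_o v (\det U).
Proof.
by split=> -[h1 h2]; split=> // i j; have := h1 i j; rewrite /in_o hordE.
Qed.

Lemma omxM m n p (A : 'M[F]_(m, n)) (B : 'M[F]_(n, p)) :
  omx A -> omx B -> omx (A *m B).
Proof.
by move=> hA hB i j; rewrite mxE; apply: hord_sum => k _; rewrite hordMo.
Qed.

Lemma omx1 n : omx (1%:M : 'M[F]_n).
Proof. by move=> i j; rewrite mxE; case: eqP => _; rewrite ?hord0 ?hord1. Qed.

Lemma hord_prod (I : Type) (r : seq I) (f : I -> F) :
  (forall i, hord (f i) 0) -> hord (\prod_(i <- r) f i) 0.
Proof.
move=> H; elim/big_ind: _ => //; first exact: hord1.
by move=> x y hx hy; rewrite hordMo.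
Qed.

Lemma hord_sign (b : bool) x k : hord ((-1) ^+ b * x) k = hord x k.
Proof. by case: b; rewrite ?mul1r // expr1 mulN1r hordN. Qed.

Lemma hord_det n (A : 'M[F]_n) : omx A -> hord (\det A) 0.
Proof. by move=> hA; apply: hord_sum => s _; rewrite hord_sign hord_prod. Qed.

Lemma hord_det_congr n (A A' : 'M[F]_n) : omx A -> omx A' ->
  (forall i j, hord (A i j - A' i j) 2) -> hord (\det A - \det A') 2.
Proof.
move=> hA hA' hh; rewrite -sumrB; apply: hord_sum => s _.
rewrite -mulrBr hord_sign.
suff: [/\ hord (\prod_i A i (s i)) 0, hord (\prod_i A' i (s i)) 0 &
          hord (\prod_i A i (s i) - \prod_i A' i (s i)) 2] by case.
elim/big_rec2: _ => [|i x y _ [hy hx hd]]; first by rewrite subrr hord0 hord1.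
split; try by rewrite hordMo.
have -> : A i (s i) * y - A' i (s i) * x =
  (A i (s i) - A' i (s i)) * y + A' i (s i) * (y - x) by ring.
apply: hordD; first by rewrite hordMo.
by rewrite hord_oM.
Qed.

Lemma unito_congr x y : unit_o v x -> hord (y - x) 2 -> unit_o v y.
Proof.
move=> /unitoE [h0 /negP h2] hd; apply/unitoE; split.
  by rewrite -[y](subrK x) hordD // (hord_le _ hd).
apply/negP => hy; apply: h2; have -> : x = y - (y - x) by ring.
exact: hordB.
Qed.

Lemma inGLoM n (U W : 'M[F]_n) : inGLo v U -> inGLo v W -> inGLo v (U *m W).
Proof.
move=> /inGLoE [oU [dU vU]] /inGLoE [oW [dW vW]]; apply/inGLoE; split.
  exact: omxM.
by split; rewrite det_mulmx ?mulf_neq0 // ord_vM // vU vW.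
Qed.

Lemma inGLo1 n : inGLo v (1%:M : 'M[F]_n).
Proof.
by apply/inGLoE; split; [exact: omx1 | rewrite det1; split; rewrite ?oner_neq0 ?ord_v1].
Qed.

Lemma inGLo_of_inv n (U W : 'M[F]_n) : omx U -> omx W -> U *m W = 1%:M -> inGLo v U.
Proof.
move=> hU hW e; apply/inGLoE; split=> //.
apply: (@unito_mulr _ (\det W)); try exact: hord_det.
by rewrite -det_mulmx e det1; split; rewrite ?oner_neq0 ?ord_v1.
Qed.

Lemma inGLo_unitmx n (U : 'M[F]_n) : inGLo v U -> U \in unitmx.
Proof. by move=> [_ [h _]]; rewrite unitmxE unitfE. Qed.

Lemma omx_inv n (U : 'M[F]_n) : inGLo v U -> omx (invmx U).
Proof.
move=> hU i j; have uU := inGLo_unitmx hU; case/inGLoE: hU => oU dU.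
rewrite /invmx uU !mxE hordMo ?unito_hordV //.
by rewrite /cofactor -signr_odd hord_sign hord_det // => x y; rewrite !mxE.
Qed.

Lemma inGLo_perm n (s : 'S_n) : inGLo v (perm_mx s : 'M[F]_n).
Proof.
apply: (@inGLo_of_inv _ _ (perm_mx s^-1)).
- by move=> i j; rewrite !mxE; case: eqP => _; rewrite ?hord0 ?hord1.
- by move=> i j; rewrite !mxE; case: eqP => _; rewrite ?hord0 ?hord1.
- by rewrite -perm_mxM mulgV perm_mx1.
Qed.

End Valuation.

(** * The quadratic form of a matrix and its polar form *)

Section Forms.
Variables (F : fieldType) (n : nat) (B : 'M[F]_n).

Definition qf (x : 'cV[F]_n) : F := (x^T *m B *m x) 0 0.
(** Symmetrised, so that it is the polar form of [qf] for arbitrary [B]; for symmetric [B] it is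
    [2 * x^T B y]. *)
Definition bf (x y : 'cV[F]_n) : F := (x^T *m B *m y) 0 0 + (y^T *m B *m x) 0 0.

Lemma addmxE m p (A C : 'M[F]_(m, p)) i j : (A + C) i j = A i j + C i j.
Proof. by rewrite mxE. Qed.

Lemma scalemxE m p t (A : 'M[F]_(m, p)) i j : (t *: A) i j = t * A i j.
Proof. by rewrite mxE. Qed.

Lemma oppmxE m p (A : 'M[F]_(m, p)) i j : (- A) i j = - A i j.
Proof. by rewrite mxE. Qed.

Lemma trmxD_cV (x y : 'cV[F]_n) : (x + y)^T = x^T + y^T.
Proof. by apply/matrixP => i j; rewrite !mxE. Qed.

Lemma trmxZ_cV t (x : 'cV[F]_n) : (t *: x)^T = t *: x^T.
Proof. by apply/matrixP => i j; rewrite !mxE. Qed.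

Lemma qfD x y : qf (x + y) = qf x + qf y + bf x y.
Proof.
rewrite /qf /bf trmxD_cV !mulmxDl !mulmxDr !addmxE; ring.
Qed.

Lemma bfC x y : bf x y = bf y x.
Proof. by rewrite /bf addrC. Qed.

Lemma bfDl x y z : bf (x + y) z = bf x z + bf y z.
Proof.
rewrite /bf trmxD_cV !mulmxDl !mulmxDr !addmxE; ring.
Qed.

Lemma bfZl t x y : bf (t *: x) y = t * bf x y.
Proof.
rewrite /bf trmxZ_cV -!scalemxAl -!scalemxAr !scalemxE; ring.
Qed.

Lemma qfZ t x : qf (t *: x) = t ^+ 2 * qf x.
Proof.
rewrite /qf trmxZ_cV -!scalemxAl -!scalemxAr !scalemxE; ring.
Qed.

Lemma bfxx x : bf x x = 2%:R * qf x.
Proof. rewrite /bf /qf; ring. Qed.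

Lemma qf0 : qf 0 = 0.
Proof. by rewrite -(scale0r 0) qfZ expr2 !mul0r. Qed.

Lemma bf0l y : bf 0 y = 0.
Proof. by rewrite -(scale0r 0) bfZl mul0r. Qed.

Lemma bfDr x y z : bf x (y + z) = bf x y + bf x z.
Proof. by rewrite bfC bfDl ![bf x _]bfC. Qed.

Lemma bfZr t x y : bf x (t *: y) = t * bf x y.
Proof. by rewrite bfC bfZl bfC. Qed.

Lemma qfN x : qf (- x) = qf x.
Proof. by rewrite -scaleN1r qfZ sqrrN expr1n mul1r. Qed.

Lemma bfNr x y : bf x (- y) = - bf x y.
Proof. by rewrite -scaleN1r bfZr mulN1r. Qed.

Lemma mulmx_sum_col m (W : 'M[F]_(n, m)) (x : 'cV_m) :
  W *m x = \sum_i x i 0 *: col i W.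
Proof.
apply/colP => i; rewrite !mxE summxE; apply: eq_bigr => j _.
by rewrite !mxE mulrC.
Qed.

End Forms.

Lemma col_mulmx (F : fieldType) m n p (A : 'M[F]_(m, n)) (T : 'M_(n, p)) i :
  col i (A *m T) = A *m col i T.
Proof. by apply/colP => j; rewrite !mxE; apply: eq_bigr => k _; rewrite mxE. Qed.

(** * Estimates in terms of the exponents of a basis *)

Section Dominated.
Variables (F : fieldType) (v : F -> int).
Hypothesis Hv : unram_ext_Q2 v.

(* [inS] without the ordering condition on the exponents. *)
Definition dom n (B : 'M[F]_n) m (W : 'M[F]_(n, m)) (e : 'I_m -> int) : Prop :=
  (forall i, hord v (qf B (col i W)) (2 * e i)) /\
  (forall i j, hord v (bf B (col i W) (col j W)) (e i + e j)).

(** The vectors with [2 * ord(x_i) + e_i >= c] for all [i] form level [c] of a filtration attached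
    to the exponents; pairing bounds on the columns of [W] extend to them by linearity. *)
Lemma bf_comb n (B : 'M[F]_n) m (W : 'M[F]_(n, m)) e (x : 'cV_m) y (c f : int) :
  (forall i, hord v (x i 0) (c - e i)) ->
  (forall i, hord v (bf B (col i W) y) (e i + f)) ->
  hord v (bf B (W *m x) y) (c + f).
Proof.
move=> hx hy; rewrite mulmx_sum_col.
elim/big_ind: _ => [|p q hp hq|i _]; first by rewrite bf0l hord0.
  by rewrite bfDl hordD.
rewrite bfZl; have -> : c + f = (c - e i) + (e i + f) by lia.
exact: hordM.
Qed.

Lemma qf_comb n (B : 'M[F]_n) m (W : 'M[F]_(n, m)) e (x : 'cV_m) (c : int) :
  dom B W e -> (forall i, hord v (x i 0) (c - e i)) -> hord v (qf B (W *m x)) (2 * c).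
Proof.
move=> [hq hb] hx; rewrite mulmx_sum_col.
(* The pairings with the columns are carried along because each new summand creates a cross term. *)
suff [] : hord v (qf B (\sum_i x i 0 *: col i W)) (2 * c) /\
  forall j, hord v (bf B (col j W) (\sum_i x i 0 *: col i W)) (e j + c) by [].
elim/big_rec: _ => [|i y _ [hy1 hy2]].
  by rewrite qf0 hord0; split=> // j; rewrite bfC bf0l hord0.
split=> [|j].
  rewrite qfD qfZ bfZl !hordD //.
    have -> : 2 * c = (c - e i) + (c - e i) + 2 * e i by lia.
    by rewrite hordM // expr2 hordM.
  have -> : 2 * c = (c - e i) + (e i + c) by lia.
  exact: hordM.
rewrite bfDr bfZr hordD //.
have -> : e j + c = (c - e i) + (e j + e i) by lia.
exact: hordM.
Qed.

Lemma dom_mulmx n (B : 'M[F]_n) m p (W : 'M[F]_(n, m)) e (T : 'M_(m, p)) e' :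
  dom B W e -> (forall k i, hord v (T k i) (e' i - e k)) -> dom B (W *m T) e'.
Proof.
move=> hW hT; split=> [i|i j]; rewrite col_mulmx.
  by apply: qf_comb hW _ => k; rewrite mxE; apply: hT.
apply: bf_comb => [k|k]; first by rewrite mxE; apply: (hT k i).
rewrite col_mulmx bfC addrC.
apply: bf_comb => [l|l]; first by rewrite mxE; apply: (hT l j).
by case: hW.
Qed.

Lemma inSE n (B : 'M[F]_n) (W : 'M[F]_n) s : B^T = B ->
  inS v (W^T *m B *m W) s <->
  [/\ size s = n, sorted leq s & dom B W (fun i => (nth 0%N s i)%:Z)].
Proof.
move=> symB.
have eqq i : (W^T *m B *m W) i i = qf B (col i W).
  by rewrite /qf tr_col -row_mul -row_mul !mxE; apply: eq_bigr => k _; rewrite !mxE.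
have eqm i j : (W^T *m B *m W) i j = ((col i W)^T *m B *m col j W) 0 0.
  by rewrite tr_col -row_mul -row_mul !mxE; apply: eq_bigr => k _; rewrite !mxE.
have eqb i j : 2%:R * (W^T *m B *m W) i j = bf B (col i W) (col j W).
  have sym : (W^T *m B *m W) j i = (W^T *m B *m W) i j.
    by rewrite -[in RHS](trmxK (W^T *m B *m W)) [in RHS]mxE !trmx_mul trmxK symB mulmxA.
  by rewrite /bf -!eqm sym; ring.
split.
  move=> [s1 [s2 h]]; split=> //; split=> [i|i j].
    by have [] := h i i (leqnn i); rewrite eqq hordE.
  wlog ij : i j / (i <= j)%N.
    by move=> H; case/orP: (leq_total i j) => /H //; rewrite bfC addrC.
  by have [_] := h i j ij; rewrite eqb /hord; case=> ->; rewrite ?orbT.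
move=> [s1 s2 [hq hb]]; split=> //; split=> // i j _; split.
  by rewrite hordE eqq; apply: hq.
by rewrite eqb; apply/orP; apply: hb.
Qed.

End Dominated.

(** * Determinants, permutations and the choice of pivots *)

(** Cauchy-Binet before collecting terms: the sum over all maps [f] is enough to find a unit
    minor. *)
Lemma det_mulmx_rect (R : comNzRingType) d n (A : 'M[R]_(d, n)) (C : 'M[R]_(n, d)) :
  \det (A *m C) = \sum_(f : {ffun 'I_d -> 'I_n})
    (\prod_i A i (f i)) * \det (\matrix_(i, j) C (f i) j).
Proof.
transitivity (\sum_(f : {ffun 'I_d -> 'I_n}) \sum_(s : 'S_d)
    (-1) ^+ s * \prod_i (A i (f i) * C (f i) (s i))).
  rewrite exchange_big; apply: eq_bigr => /= s _; rewrite -big_distrr /=.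
  rewrite -(bigA_distr_bigA (fun i j => A i j * C j (s i))); congr (_ * _).
  by apply: eq_bigr => i _; rewrite mxE.
apply: eq_bigr => f _; rewrite mulr_sumr; apply: eq_bigr => s _.
rewrite big_split /= mulrCA; congr (_ * (_ * _)).
by apply: eq_bigr => i _; rewrite mxE.
Qed.

Lemma Cramer_col (F : fieldType) d (K : 'M[F]_d) (u : 'cV_d) i : K \in unitmx ->
  \det (\matrix_(a, b) if b == i then u a 0 else K a b) = \det K * (invmx K *m u) i 0.
Proof.
move=> uK; rewrite (expand_det_col _ i) [(invmx K *m u) i 0]mxE mulr_sumr.
apply: eq_bigr => r _; rewrite mxE eqxx /invmx uK !mxE.
have -> : cofactor (\matrix_(a, b) if b == i then u a 0 else K a b) r i = cofactor K r i.
  rewrite /cofactor; congr (_ * \det _); apply/matrixP => a b; rewrite !mxE.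
  by rewrite eq_sym (negbTE (neq_lift _ _)).
rewrite [RHS]mulrA [\det K * _]mulrA divff; first by rewrite mul1r mulrC.
by rewrite -unitfE -unitmxE.
Qed.

Lemma extend_inj_perm n1 d (f : 'I_d -> 'I_(n1 + d)) : injective f ->
  exists s : 'S_(n1 + d), forall i, s (rshift n1 i) = f i.
Proof.
move=> f_inj; pose s0 := [seq x <- enum 'I_(n1 + d) | x \notin codom f].
have us : uniq (s0 ++ codom f).
  rewrite cat_uniq filter_uniq ?enum_uniq //= (map_inj_uniq f_inj) enum_uniq andbT.
  by apply/hasPn => x xf; rewrite mem_filter negb_and negbK xf.
have ps : perm_eq (s0 ++ codom f) (enum 'I_(n1 + d)).
  apply: uniq_perm => //; first exact: enum_uniq.
  by move=> x; rewrite mem_cat mem_filter mem_enum andbT orNb.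
have sz : size (s0 ++ codom f) = (n1 + d)%N by rewrite (perm_size ps) size_enum_ord.
have sz0 : size s0 = n1.
  by move: sz; rewrite size_cat size_codom card_ord; lia.
have g_inj : injective (fun i : 'I_(n1 + d) => nth i (s0 ++ codom f) i).
  move=> i j; rewrite (set_nth_default i) ?sz // => /eqP.
  by rewrite nth_uniq ?sz // => /eqP/val_inj.
exists (perm g_inj) => i; rewrite permE nth_cat /= sz0 ltnNge leq_addr /= addKn.
rewrite (nth_map i) ?size_enum_ord //.
by rewrite nth_ord_enum.
Qed.

(** Rearrangement inequality: removing the inversion raises the sum by [(y - x) * (s x - s y)]. *)
Lemma sum_mul_perm_swap n (s : 'S_n) (x y : 'I_n) : (x < y)%N -> (s y < s x)%N ->
  (\sum_(i < n) i * s i < \sum_(i < n) i * (tperm x y * s)%g i)%N.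
Proof.
move=> xy sxy; have yx : y != x by apply: contraTneq xy => ->; rewrite ltnn.
rewrite (bigD1 x) // (bigD1 y) //= [X in (_ < X)%N](bigD1 x) // [X in (_ < _ + X)%N](bigD1 y) //=.
rewrite !permM tpermL tpermR.
rewrite [X in (_ < _ + (_ + X))%N](eq_bigr (fun i : 'I_n => (i * s i)%N)); last first.
  by move=> i /andP[ix iy]; rewrite permM tpermD // eq_sym.
move: (\sum_(i < n | _) _)%N (nat_of_ord x) (nat_of_ord y) (nat_of_ord (s x))
  (nat_of_ord (s y)) xy sxy => R a b c e; nia.
Qed.

Section Pivots.
Variables (F : fieldType) (v : F -> int).
Hypothesis Hv : unram_ext_Q2 v.

(* Maximising [\sum_i i * s i] pushes the pivot columns as far to the right as possible. *)
Lemma pivots n1 d (Y : 'M[F]_(d, n1 + d)) (V : 'M[F]_(n1 + d, d)) :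
  omx v Y -> omx v V -> Y *m V = 1%:M ->
  exists s : 'S_(n1 + d), let K := rsubmx (col_perm s Y) in
  [/\ inGLo v K,
      (forall i j : 'I_n1, (i < j)%N -> (s (lshift d i) < s (lshift d j))%N),
      (forall i j : 'I_d, (i < j)%N -> (s (rshift n1 i) < s (rshift n1 j))%N) &
      (forall (j : 'I_n1) (i : 'I_d),
         ~~ hord v ((invmx K *m lsubmx (col_perm s Y)) i j) 2 ->
         (s (lshift d j) < s (rshift n1 i))%N)].
Proof.
move=> oY oV YV; pose P (s : 'S_(n1 + d)) := ~~ hord v (\det (rsubmx (col_perm s Y))) 2.
have [s0 Ps0] : exists s, P s.
  (* This determinant is 1, so some choice [f] of [d] columns of [Y] has a unit minor; a repeated
     column would make the minor vanish. *)
  have : ~~ hord v (\det (V^T *m Y^T)) 2.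
    by rewrite -trmx_mul YV trmx1 det1 /hord oner_eq0 (ord_v1 Hv).
  rewrite det_mulmx_rect => hs.
  have [f hf] : exists f : {ffun 'I_d -> 'I_(n1 + d)},
      ~~ hord v (\det (\matrix_(i, j) Y^T (f i) j)) 2.
    apply/existsP; apply: contraR hs => /existsPn hs; apply: hord_sum => // f _.
    apply: hord_oM => //; last by rewrite -[hord _ _ _]negbK.
    by apply: hord_prod => // i; rewrite mxE.
  have f_inj : injective f.
    move=> i j fij; apply/eqP; apply: contraR hf => ij.
    rewrite (determinant_alternate ij) ?hord0 // => k.
    by rewrite !mxE fij.
  have [s sf] := extend_inj_perm f_inj; exists s; rewrite /P -det_tr.
  suff -> : (rsubmx (col_perm s Y))^T = \matrix_(i, j) Y^T (f i) j by [].
  by apply/matrixP => i j; rewrite !mxE sf.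
case: (arg_maxnP (fun s : 'S_(n1 + d) => \sum_(i < n1 + d) i * s i)%N Ps0) => s Ps smax.
(* If exchanging [x] and [y] keeps the pivot minor a unit, maximality puts [s x] before [s y]. *)
have key (x y : 'I_(n1 + d)) : (x < y)%N -> P (tperm x y * s)%g -> (s x < s y)%N.
  move=> xy /smax le; rewrite ltn_neqAle; apply/andP; split.
    by apply: contraTneq xy => /val_inj/perm_inj ->; rewrite ltnn.
  by rewrite leqNgt; apply/negP => /(sum_mul_perm_swap xy); rewrite ltnNge => /negP; apply.
have oYs : omx v (col_perm s Y) by move=> i j; rewrite mxE.
have oK : omx v (rsubmx (col_perm s Y)) by move=> i j; rewrite !mxE.
have GK : inGLo v (rsubmx (col_perm s Y)).
  by apply/inGLoE; split=> //; apply/unitoE => //; split=> //; apply: hord_det.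
exists s; split=> // [i j ij|i j ij|j i hij]; apply: key => //=.
(* Exchanging two non-pivots leaves the minor unchanged, and exchanging two pivots only changes its
   sign. *)
- rewrite /P (_ : rsubmx _ = rsubmx (col_perm s Y)) //; apply/matrixP => a b.
  by rewrite !mxE permM tpermD // ?eq_lrshift ?eq_rlshift.
- by rewrite ltn_add2l.
- rewrite /P (_ : rsubmx _ = col_perm (tperm i j) (rsubmx (col_perm s Y))).
    by rewrite col_permE det_mulmx det_perm mulrC hord_sign.
  apply/matrixP => a b; rewrite !mxE permM; congr (Y _ (s _)).
  case: (tpermP i j b) => [->|->|/eqP bi /eqP bj]; rewrite ?tpermL ?tpermR //.
  by rewrite tpermD // eq_rshift eq_sym.
- by have := ltn_ord j; lia.
(* By Cramer's rule, exchanging non-pivot [j] with pivot [i] multiplies the minor by the coefficient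
   of column [j] at pivot [i]. *)
- rewrite /P.
  have -> : rsubmx (col_perm (tperm (lshift d j) (rshift n1 i) * s) Y) =
     \matrix_(a, b) if b == i then (col j (lsubmx (col_perm s Y))) a 0
                    else rsubmx (col_perm s Y) a b.
    apply/matrixP => a b; rewrite !mxE permM; case: eqP => [->|/eqP bi].
      by rewrite tpermR.
    by rewrite tpermD // ?eq_lrshift // eq_rshift eq_sym.
  rewrite Cramer_col ?(inGLo_unitmx GK) // -col_mulmx [col j _ i 0]mxE.
  case/inGLoE: GK => _ [dK vdK]; apply: contra hij.
  rewrite /hord mulf_eq0 (negbTE dK) /=; case: eqP => //= /eqP t0.
  by rewrite ord_vM // vdK add0r.
Qed.
End Pivots.

(** * Lexicographic comparison and GK invariants *)

(** The heads satisfy [x <= y <= z <= x], so they agree and the induction passes to the tails. *)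
Lemma lexle_squeeze (e a1 a : seq nat) : size e = size a -> size a1 = size a ->
  lexle e a1 -> lexle a1 a ->
  (forall i, (i < size a)%N -> (nth 0%N a i <= nth 0%N e i)%N) -> a1 = a /\ e = a.
Proof.
elim: a e a1 => [|x a IH] [|y e] [|z a1] //= [se] [s1] h1 h2 hp.
have := hp 0%N isT; rewrite /= => xy.
have [yz zx] : y = z /\ z = x.
  by case/orP: h1 => [|/andP[/eqP]]; case/orP: h2 => [|/andP[/eqP]]; lia.
subst y z; move: h1 h2; rewrite !ltnn eqxx /= => h1 h2.
by have [i /(hp i.+1)|-> ->] := IH e a1 se s1 h1 h2.
Qed.

Lemma lexle_refl s : lexle s s.
Proof. by elim: s => //= x s ->; rewrite eqxx orbT. Qed.

Lemma lexle_cat_take a1 b a : lexle (a1 ++ b) a -> lexle a1 (take (size a1) a).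
Proof.
elim: a1 a => [|x a1 IH] [|y a] //=.
by case/orP => [->//|/andP[-> /IH ->]]; rewrite orbT.
Qed.

Section GK.
Variables (F : fieldType) (v : F -> int).
Hypothesis Hv : unram_ext_Q2 v.

Lemma isGK_dom n (B : 'M[F]_n) a : B^T = B -> isGK v B a ->
  [/\ size a = n, sorted leq a &
      exists2 W, inGLo v W & dom v B W (fun i => (nth 0%N a i)%:Z)].
Proof.
by move=> symB [[W [GW /(inSE v W a symB).1 [sa soa dW]]] _]; split=> //; exists W.
Qed.

Lemma isGK_lexle n (B : 'M[F]_n) a W e s : B^T = B -> isGK v B a ->
  inGLo v W -> dom v B W e -> size s = n -> sorted leq s ->
  (forall i, e i = (nth 0%N s i)%:Z) -> lexle s a.
Proof.
move=> symB [_ amax] GW [dq db] ss so es; apply: amax; exists W; split=> //.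
by apply/inSE => //; split=> //; split=> [i|i j]; rewrite -!es.
Qed.

Lemma inGLo_col_perm n (W : 'M[F]_n) s : inGLo v W -> inGLo v (col_perm s W).
Proof. by move=> GW; rewrite col_permE; apply: inGLoM => //; apply: inGLo_perm. Qed.

Lemma dom_col_perm n (B W : 'M[F]_n) e s :
  dom v B W e -> dom v B (col_perm s W) (fun i => e (s i)).
Proof.
have E i : col i (col_perm s W) = col (s i) W by apply/colP => j; rewrite !mxE.
by move=> [dq db]; split=> [i|i j]; rewrite !E.
Qed.

Lemma sorted_nth_le (a : seq nat) i j : sorted leq a -> (i <= j)%N -> (j < size a)%N ->
  (nth 0%N a i <= nth 0%N a j)%N.
Proof.
move=> so ij js; apply: (sorted_leq_nth leq_trans leqnn) => //.
by rewrite inE (leq_ltn_trans ij).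
Qed.

(* The form induced by [B] on the graded pieces of the filtration with exponents [a] has no
   singular vector in its radical: such a vector, reduced to its leading terms and scaled,
   could replace a basis vector and raise its exponent. *)
Lemma isGK_nonsingular n (B : 'M[F]_n) a W (D : 'cV[F]_n) (k : int) :
  B^T = B -> isGK v B a -> inGLo v W -> dom v B W (fun i => (nth 0%N a i)%:Z) ->
  (forall j : 'I_n, hord v (bf B (W *m D) (col j W)) (k + 1 + (nth 0%N a j)%:Z)) ->
  hord v (qf B (W *m D)) (2 * (k + 1)) ->
  forall j : 'I_n, hord v (D j 0) (k + 1 - (nth 0%N a j)%:Z).
Proof.
move=> symB gk GW dW hb hq; have [sa so _] := isGK_dom symB gk.
apply/forallP; apply: contraT => /forallPn [j0].
rewrite /hord negb_or => /andP[Pj0 wj0]; exfalso.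
(* [w j] is the level of the [j]-th term of [D]; the counterexample [j0] makes the lowest level [c]
   at most [k]. *)
pose w (j : 'I_n) : int := 2 * v (D j 0) + (nth 0%N a j)%:Z.
have [p0 Pp0 minp] := @arg_minP _ _ _ j0 (fun j => D j 0 != 0) w Pj0.
pose c := w p0; have ck : c <= k by have := minp _ Pj0; rewrite /c {2}/w; lia.
pose Q j := (D j 0 != 0) && (w j == c).
have Qp0 : Q p0 by rewrite /Q Pp0 eqxx.
(* [p] is the last index of lowest level, and [p'] the last index with the same exponent, where an
   increase by one keeps the sequence sorted. *)
case: (arg_maxnP (fun j : 'I_n => nat_of_ord j) Qp0) => p /andP[Dp0 /eqP wp] maxp.
case: (@arg_maxnP _ p (fun j => nth 0%N a j == nth 0%N a p) (fun j : 'I_n => nat_of_ord j)) => //.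
move=> p' /eqP ap' maxp'.
(* The leading part [D0] differs from [D] by terms of level at least [c + 1], so it satisfies both
   hypotheses with [c] in place of [k]. *)
pose D0 := \col_j (if Q j then D j 0 else 0).
pose D1 := D - D0.
have hD1 j : hord v (D1 j 0) (c + 1 - (nth 0%N a j)%:Z).
  rewrite !mxE /Q; case: (eqVneq (D j 0) 0) => [->|Dj0] /=; first by rewrite subr0 hord0.
  case: eqP => [|wj]; first by rewrite subrr hord0.
  by have := minp _ Dj0; rewrite subr0 /hord (negbTE Dj0) /= -/c; move: wj; rewrite /w; lia.
have zE : W *m D0 = W *m D - W *m D1 by rewrite -mulmxBr /D1 opprB addrC subrK.
have hb1 y f : (forall j : 'I_n, hord v (bf B (col j W) y) ((nth 0%N a j)%:Z + f)) ->
    hord v (bf B (W *m D1) y) (c + 1 + f).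
  by move=> h; apply: bf_comb h.
have hb0 j : hord v (bf B (W *m D0) (col j W)) (c + 1 + (nth 0%N a j)%:Z).
  rewrite zE bfDl -[- (W *m D1)]scaleN1r bfZl mulN1r hordB //.
    by apply: hord_le (hb j); lia.
  by apply: hb1 => i; case: dW.
have hq0 : hord v (qf B (W *m D0)) (2 * (c + 1)).
  rewrite zE qfD qfN bfNr [bf _ _ (W *m D1)]bfC !hordD ?hordN //.
  - by apply: hord_le hq; lia.
  - by apply: qf_comb dW _ => // j; apply: hD1.
  - apply: (@hord_le _ _ _ (c + 1 + (k + 1))); first by lia.
    by apply: hb1 => j; rewrite bfC addrC.
pose t := (D p 0)^-1 *: D0.
have tp : t p 0 = 1 by rewrite !mxE /Q Dp0 wp eqxx /= mulVf.
(* On the leading terms [2 * ord(D_j) + a_j = c] with [a_j <= a_p], so the coefficient at [p] has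
   the smallest order. *)
have ot : omx v t.
  move=> j i; rewrite ord1 !mxE; case: ifP => [Qj|_]; last by rewrite mulr0 hord0.
  case/andP: (Qj) => Dj0 /eqP wj; rewrite /hord mulf_eq0 invr_eq0 (negbTE Dp0) (negbTE Dj0) /=.
  rewrite ord_vM ?invr_eq0 // ord_vV //.
  have := sorted_nth_le so (maxp _ Qj); rewrite sa ltn_ord => /(_ isT).
  by move: wj wp; rewrite /w; lia.
(* Multiplication by [1 + N] replaces basis vector [p] by the combination [t]; since [N] squares to
   zero, the inverse is [1 - N]. *)
pose N : 'M[F]_n := (t - delta_mx p 0) *m (delta_mx 0 p : 'rV_n).
have NN : N *m N = 0.
  rewrite /N mulmxA -[_ *m _ *m (t - _)]mulmxA.
  have -> : (delta_mx 0 p : 'rV_n) *m (t - delta_mx p 0) = 0.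
    apply/matrixP => i j; rewrite !ord1 -rowE !mxE eqxx /=; move: tp; rewrite !mxE => ->.
    by rewrite subrr.
  by rewrite mulmx0 mul0mx.
have oN : omx v N.
  apply: omxM => // i j; rewrite !mxE.
    rewrite hordB //; first by have := ot i j; rewrite !mxE.
    by case: andP; rewrite ?hord0 ?hord1.
  by case: andP; rewrite ?hord0 ?hord1.
have GT : inGLo v (1%:M + N).
  apply: (@inGLo_of_inv _ _ Hv _ _ (1%:M - N)).
  - by move=> i j; rewrite addmxE hordD //; apply: omx1.
  - by move=> i j; rewrite addmxE hordD //; [apply: omx1 | rewrite mxE hordN].
  - by rewrite mulmxDl mulmxBr mulmxBr NN mul1mx mulmx1 mul1mx subr0 subrK.
pose W' := W *m (1%:M + N).
have colj j : j != p -> col j W' = col j W.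
  move=> jp; rewrite /W' col_mulmx !colE mulmxDl mul1mx /N -mulmxA mul_delta_mx_0 1?eq_sym //.
  by rewrite mulmx0 addr0.
have colp : col p W' = (D p 0)^-1 *: (W *m D0).
  rewrite /W' col_mulmx scalemxAr -/t; congr (_ *m _).
  rewrite colE mulmxDl mul1mx /N -mulmxA mul_delta_mx.
  have -> : (delta_mx 0 0 : 'M[F]_1) = 1%:M.
    by apply/matrixP => i j; rewrite !ord1 !mxE.
  by rewrite mulmx1 addrC subrK.
pose e (j : 'I_n) : int := (nth 0%N a j)%:Z + (j == p)%:Z.
have hDV : hord v (D p 0)^-1 ((nth 0%N a p)%:Z - c).
  by rewrite /hord ord_vV // invr_eq0 (negbTE Dp0) /=; move: wp; rewrite /w; lia.
have hqp : hord v (qf B (col p W')) (2 * ((nth 0%N a p)%:Z + 1)).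
  rewrite colp qfZ expr2; move: (hordM Hv (hordM Hv hDV hDV) hq0); apply: hord_le; lia.
have hbp j : hord v (bf B (col p W') (col j W)) ((nth 0%N a p)%:Z + 1 + (nth 0%N a j)%:Z).
  by rewrite colp bfZl; move: (hordM Hv hDV (hb0 j)); apply: hord_le; lia.
have dW' : dom v B W' e.
  case: dW => dq db; split=> [i|i j]; rewrite /e.
    case: (eqVneq i p) => [->|ip]; first exact: hqp.
    by rewrite colj // addr0.
  case: (eqVneq i p) => [->|ip]; case: (eqVneq j p) => [->|jp].
  - rewrite bfxx; move: (hordM Hv (hord2 Hv) hqp); apply: hord_le; lia.
  - by rewrite [col j W']colj // addr0.
  - by rewrite [col i W']colj // bfC addr0 addrC.
  - by rewrite !colj // !addr0.
(* The transposition of [p] and [p'], whose exponents in [a] are equal, moves the raised exponent to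
   [p']; the resulting sequence is sorted and exceeds [a]. *)
pose s := mkseq (fun i => (nth 0%N a i + (i == p'))%N) n.
have sE i : (i < n)%N -> nth 0%N s i = (nth 0%N a i + (i == p'))%N.
  by move=> i_n; rewrite nth_mkseq.
have : lexle s a.
  apply: (isGK_lexle symB gk _ (dom_col_perm (tperm p p') dW')).
  - by apply: inGLo_col_perm; apply: inGLoM.
  - by rewrite size_mkseq.
  - apply/(sortedP 0%N) => i; rewrite size_mkseq => i_n.
    rewrite !sE //; last exact: ltnW.
    have := sorted_nth_le so (leqnSn i); rewrite sa => /(_ i_n).
    case: (eqVneq i p') => [ip|] /=; last by case: eqP; lia.
    have /= := maxp' (Ordinal i_n); case: eqP => [_ /(_ isT)|]; first by lia.
    by rewrite -ap' -ip; lia.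
  - move=> i; rewrite /e sE //; case: (tpermP p p' i) => [->|->|ip ip'].
    + by rewrite ap' (eq_sym p' p) PoszD.
    + by rewrite !eqxx ap'; lia.
    + rewrite (introF eqP ip) (_ : (nat_of_ord i == p') = false) ?addn0 ?addr0 //.
      by apply/eqP => /val_inj.
have ss : size s = size a by rewrite size_mkseq.
move=> h; have [i i_n|_ sEa] := lexle_squeeze ss (erefl _) h (lexle_refl a).
  by rewrite sE -?sa // leq_addr.
by have := sE p' (ltn_ord p'); rewrite sEa eqxx; lia.
Qed.

End GK.

(** * Counting exponents, and forms on orthogonal sums *)

Lemma nth_map_enum_ord n (f : 'I_n -> nat) (i : 'I_n) :
  nth 0%N [seq f j | j <- enum 'I_n] i = f i.
Proof. by rewrite (nth_map i) ?size_enum_ord // nth_ord_enum. Qed.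

Lemma count_map_enum_ord n (f : 'I_n -> nat) (P : pred nat) :
  count P [seq f j | j <- enum 'I_n] = (\sum_(i < n) P (f i))%N.
Proof.
rewrite -sum1_count big_map big_mkcond big_enum; apply: eq_bigr => i _.
by case: (P _).
Qed.

(** A permutation preserves the total sum, so agreement on the first [n1] indices forces it on the
    rest. With [P] an indicator this counts exponents. *)
Lemma sum_perm_split n1 d (s : 'S_(n1 + d)) (f : 'I_(n1 + d) -> nat) (P : nat -> nat) :
  (forall j : 'I_n1, P (f (s (lshift d j))) = P (f (lshift d j))) ->
  (\sum_(i < d) P (f (s (rshift n1 i))) = \sum_(i < d) P (f (rshift n1 i)))%N.
Proof.
move=> h.
have : (\sum_x P (f x) = \sum_x P (f (s x)))%N by apply: reindex_inj; apply: perm_inj.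
rewrite !big_split_ord /= [X in (_ = X + _)%N](eq_bigr _ (fun i _ => h i)) => /eqP.
by rewrite eqn_add2l => /eqP.
Qed.

Section Blocks.
Variables (F : fieldType) (n1 d : nat) (B1 : 'M[F]_n1) (C : 'M[F]_d).

Lemma bilin_block (x x' : 'cV[F]_n1) (y y' : 'cV[F]_d) :
  (col_mx x y)^T *m block_mx B1 0 0 C *m col_mx x' y' = x^T *m B1 *m x' + y^T *m C *m y'.
Proof.
rewrite tr_col_mx mul_row_block !mulmx0 addr0 add0r mul_row_col.
by [].
Qed.

Lemma qf_block (x : 'cV[F]_n1) (y : 'cV[F]_d) :
  qf (block_mx B1 0 0 C) (col_mx x y) = qf B1 x + qf C y.
Proof. by rewrite /qf bilin_block addmxE. Qed.

Lemma bf_block (x x' : 'cV[F]_n1) (y y' : 'cV[F]_d) :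
  bf (block_mx B1 0 0 C) (col_mx x y) (col_mx x' y') = bf B1 x x' + bf C y y'.
Proof. by rewrite /bf !bilin_block !addmxE; ring. Qed.

End Blocks.

(** * Extending an optimal basis of [L_1] to [L_B] *)

Section Core.
Variables (F : fieldType) (v : F -> int).
Hypothesis Hv : unram_ext_Q2 v.

Lemma inGLo_lblock n1 d (t : 'M[F]_(d, n1)) :
  omx v t -> inGLo v (block_mx 1%:M 0 (- t) 1%:M).
Proof.
move=> ot; apply/inGLoE; split; last first.
  by rewrite det_lblock !det1 mulr1; split; rewrite ?oner_neq0 ?(ord_v1 Hv).
move=> i j; rewrite -[i]splitK -[j]splitK.
case: (split i) => i'; case: (split j) => j' /=.
- by rewrite block_mxEul; apply: omx1.
- by rewrite block_mxEur mxE hord0.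
- by rewrite block_mxEdl mxE hordN.
- by rewrite block_mxEdr; apply: omx1.
Qed.

(* [col l Z] lies in the radical of the reduced form, hence has the exact order [k + 2]; a multiple
   of it by an element of order at least [-1] turns [x] into a singular radical vector. *)
Lemma no_second_radical_vector n1 (B1 Z : 'M[F]_n1) a1 (l : 'I_n1) (x : 'cV[F]_n1) (k : nat) :
  B1^T = B1 -> isGK v B1 a1 -> inGLo v Z -> dom v B1 Z (fun j => (nth 0%N a1 j)%:Z) ->
  nth 0%N a1 l = k.+2 ->
  (forall j, hord v (bf B1 (col l Z) (col j Z)) (k%:Z + 3 + (nth 0%N a1 j)%:Z)) ->
  omx v x ->
  (forall j, hord v (bf B1 x (col j Z)) (k%:Z + 2 + (nth 0%N a1 j)%:Z)) ->
  hord v (qf B1 x) (2 * k%:Z) -> hord v (qf B1 x) (2 * k%:Z + 2).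
Proof.
move=> symB1 gkB1 GZ dZa a_l hbl ox hbx hqx.
have h2V : hord v 2%:R^-1 (-2).
  by rewrite /hord (ord_vV Hv) ?(two_neq0 Hv) // (ord_v2 Hv) orbT.
have h4 : hord v (2%:R ^+ 2) 4 by move: (hordM Hv (hord2 Hv) (hord2 Hv)).
(* Otherwise nonsingularity would put [col l Z] in level [k + 3], whereas its coordinate 1 at [l]
   has level [k + 2]. *)
have q_l : ~~ hord v (qf B1 (col l Z)) (2 * (k%:Z + 2 + 1)).
  apply/negP; rewrite colE => h.
  have hbl' j : hord v (bf B1 (Z *m delta_mx l 0) (col j Z)) (k%:Z + 2 + 1 + (nth 0%N a1 j)%:Z).
    by rewrite -colE; apply: hord_le (hbl j); lia.
  have := isGK_nonsingular Hv symB1 gkB1 GZ dZa hbl' h l.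
  by rewrite mxE !eqxx a_l /hord oner_eq0 (ord_v1 Hv); lia.
have q_l2 : hord v (qf B1 (col l Z)) (2 * (k%:Z + 2)).
  by case: dZa => dq _; apply: hord_le (dq l); rewrite a_l; lia.
have ql0 : qf B1 (col l Z) != 0 by move: q_l; rewrite /hord negb_or => /andP[].
have vql : v (qf B1 (col l Z)) = k%:Z + 2.
  by move: q_l q_l2; rewrite /hord (negbTE ql0) /=; lia.
have hqlV : hord v (qf B1 (col l Z))^-1 (- (2 * (k%:Z + 2))).
  by rewrite /hord (ord_vV Hv) // vql; apply/orP; right; lia.
(* For [r^2] congruent to [u] modulo 2 and [lam = r / 2], the value of [x + lam * col l Z] without
   its cross term is [qf (col l Z) * (r^2 - u) / 4], of order at least [k + 1]. *)
pose u := - (2%:R ^+ 2 * qf B1 x / qf B1 (col l Z)).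
have hu : hord v u 0.
  by rewrite hordN //; move: (hordM Hv (hordM Hv h4 hqx) hqlV); apply: hord_le; lia.
have [r hr hru] := sqrt_mod2 Hv hu.
pose lam := r / 2%:R.
have hlam : hord v lam (-2) by apply: hord_oM.
have two0 := two_neq0 Hv.
pose dd := invmx Z *m x.
have Zdd : Z *m dd = x by rewrite /dd mulKVmx // (inGLo_unitmx GZ).
have oD : omx v dd by apply: omxM => //; exact: omx_inv.
pose D := dd + lam *: delta_mx l 0.
have ZD : Z *m D = x + lam *: col l Z by rewrite mulmxDr Zdd -scalemxAr -colE.
have hD : forall j : 'I_n1, hord v (D j 0) (k%:Z + 1 - (nth 0%N a1 j)%:Z).
  apply: (isGK_nonsingular Hv symB1 gkB1 GZ dZa) => [j|]; rewrite ZD.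
    rewrite bfDl bfZl hordD //; first by apply: hord_le (hbx j); clear; lia.
    by move: (hordM Hv hlam (hbl j)); apply: hord_le; clear; lia.
  rewrite qfD qfZ bfZr hordD //; last first.
    by move: (hordM Hv hlam (hbx l)); apply: hord_le; rewrite a_l; clear; lia.
  have -> : qf B1 x + lam ^+ 2 * qf B1 (col l Z) =
      2%:R^-1 * 2%:R^-1 * qf B1 (col l Z) * (r ^+ 2 - u).
    by rewrite /u /lam; field; rewrite ql0 two0.
  by move: (hordM Hv (hordM Hv (hordM Hv h2V h2V) q_l2) hru); apply: hord_le; clear; lia.
(* [D] and [dd] agree away from [l], and at [l] integrality suffices because [a_l = k + 2]; so [x]
   itself lies in level [k + 1]. *)
rewrite -Zdd; apply: (@hord_le _ _ _ (2 * (k%:Z + 1))); first by clear; lia.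
apply: qf_comb dZa _ => // j; case: (eqVneq j l) => [->|jl].
  by apply: hord_le (oD l 0); rewrite a_l; clear; lia.
by have := hD j; rewrite addmxE scalemxE [delta_mx _ _ _ _]mxE (negbTE jl) mulr0 addr0.
Qed.

Section Extension.
Variables (n1 d : nat) (B1 : 'M[F]_n1) (C : 'M[F]_d) (a a1 : seq nat) (k : nat).
Let B := block_mx B1 0 0 C.
Hypotheses (symB1 : B1^T = B1) (symC : C^T = C) (d_gt0 : (0 < d)%N).
Hypothesis qC : forall y : 'cV[F]_d, omx v y -> hord v (qf C y) (2 * k%:Z).
Hypotheses (gkB : isGK v B a) (gkB1 : isGK v B1 a1).
Hypothesis ext : exists b, SS v B (a1 ++ b).
Hypothesis a_le : (nth 0%N a n1 <= k.+2)%N.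
(** A non-diagonal block yields the first alternative; a diagonal one yields the second, with polar
    form divisible by [2^(k+1)] and a value of exact order [k]. *)
Hypothesis C_or : (nth 0%N a n1 < k.+2)%N \/
  ((forall y z : 'cV[F]_d, omx v y -> omx v z -> hord v (bf C y z) (2 * k%:Z + 2)) /\
   (exists2 y : 'cV[F]_d, omx v y & ~~ hord v (qf C y) (2 * k%:Z + 2))).

Lemma extend_optimal_basis : exists U : 'M[F]_(n1 + d),
  [/\ inGLo v U, dom v B U (fun i => (nth 0%N a i)%:Z), dlsubmx U = 0 & take n1 a = a1].
Proof.
have symB : B^T = B by rewrite /B tr_block_mx symB1 symC !trmx0.
have [sa so [W GW dW]] := isGK_dom symB gkB.
have a_mono i j : (i <= j)%N -> (j < n1 + d)%N -> (nth 0%N a i <= nth 0%N a j)%N.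
  by move=> ij jn; apply: sorted_nth_le => //; rewrite sa.
have an1 (j : 'I_n1) : (nth 0%N a j <= nth 0%N a n1)%N.
  by apply: a_mono; [exact: ltnW | lia].
have YV : dsubmx W *m rsubmx (invmx W) = 1%:M.
  apply/matrixP => i j; have := mulmxV (inGLo_unitmx GW).
  move/matrixP => /(_ (rshift n1 i) (rshift n1 j)); rewrite !mxE eq_rshift => <-.
  by apply: eq_bigr => x _; rewrite !mxE.
have [||s []] := pivots Hv _ _ YV.
- by move=> i j; rewrite mxE; case/inGLoE: GW.
- by move=> i j; rewrite mxE; apply: omx_inv.
pose W1 := col_perm s W.
have -> : col_perm s (dsubmx W) = dsubmx W1 by apply/matrixP => i j; rewrite !mxE.
rewrite -/(dlsubmx W1) -/(drsubmx W1).
set K := drsubmx W1; set Y1 := dlsubmx W1 => GK sl sr st.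
have GW1 : inGLo v W1 by apply: inGLo_col_perm.
have dW1 : dom v B W1 (fun i => (nth 0%N a (s i))%:Z) := dom_col_perm s dW.
have oW1 : omx v W1 by case/inGLoE: GW1.
pose X1 := ulsubmx W1; pose X2 := ursubmx W1.
have W1E : W1 = block_mx X1 X2 Y1 K by rewrite submxK.
have oX2 : omx v X2.
  by move=> i j; rewrite !mxE; have := oW1 (lshift d i) (rshift n1 j); rewrite !mxE.
have oK : omx v K by case/inGLoE: GK.
have oX1 : omx v X1.
  by move=> i j; rewrite !mxE; have := oW1 (lshift d i) (lshift d j); rewrite !mxE.
have oY1 : omx v Y1.
  by move=> i j; rewrite !mxE; have := oW1 (rshift n1 i) (lshift d j); rewrite !mxE.
pose t := invmx K *m Y1.
have ot : omx v t by apply: omxM => //; apply: omx_inv.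
have Kt : K *m t = Y1 by rewrite /t mulKVmx // (inGLo_unitmx GK).
pose al (j : 'I_n1) := nth 0%N a (s (lshift d j)).
pose be (i : 'I_d) := nth 0%N a (s (rshift n1 i)).
(* A unit coefficient forces its pivot to lie further right, hence to have at least as large an
   exponent. *)
have ht i j : hord v (t i j) 2 \/ (al j <= be i)%N.
  case: (boolP (hord v (t i j) 2)) => [|/st lt]; first by left.
  by right; apply: a_mono => //; apply: ltnW.
clearbody t.
(* Up to [be i + 2] the subtraction respects the exponents: an even coefficient supplies the missing
   order, and any other has [al j <= be i]. The coefficients left in [t2] are all even. *)
pose t1 := \matrix_(i, j) if (al j <= (be i).+2)%N then t i j else 0.
have ot1 : omx v t1 by move=> i j; rewrite mxE; case: ifP; rewrite ?hord0.
pose t2 := t - t1.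
have ht2 i j : hord v (t2 i j) 2.
  rewrite /t2 addmxE !mxE; case: ifP => [_|ab]; first by rewrite subrr hord0.
  by rewrite subr0; case: (ht i j) => //; lia.
pose T : 'M[F]_(n1 + d) := block_mx 1%:M 0 (- t1) 1%:M.
pose W2 := W1 *m T.
have GW2 : inGLo v W2 by apply: inGLoM => //; apply: inGLo_lblock.
have dW2 : dom v B W2 (fun i => (nth 0%N a (s i))%:Z).
  apply: dom_mulmx dW1 _ => // x y; rewrite -[x]splitK -[y]splitK.
  case: (split x) => i; case: (split y) => j /=.
  - rewrite block_mxEul mxE; case: (eqVneq i j) => [->|_]; last by rewrite hord0.
    by rewrite subrr hord1.
  - by rewrite block_mxEur mxE hord0.
  - rewrite block_mxEdl !mxE hordN // -/(al j) -/(be i); case: ifP => [ab|_]; last by rewrite hord0.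
    case: (ht i j) => [|ab']; first by apply: hord_le; lia.
    by apply: hord_le (ot i j); lia.
  - rewrite block_mxEdr mxE; case: (eqVneq i j) => [->|_]; last by rewrite hord0.
    by rewrite subrr hord1.
pose Z := X1 - X2 *m t1.
have W2E : W2 = block_mx Z X2 (K *m t2) K.
  rewrite /W2 W1E mulmx_block !mulmx1 !mulmx0 !add0r !mulmxN.
  by rewrite /t2 mulmxBr Kt.
pose G := 2%:R^-1 *: (K *m t2).
have GE : K *m t2 = 2%:R *: G by rewrite scalerA divff ?scale1r // (two_neq0 Hv).
have h2V : hord v 2%:R^-1 (-2).
  by rewrite /hord (ord_vV Hv) ?(two_neq0 Hv) // (ord_v2 Hv) orbT.
have oG : omx v G.
  move=> i j; have h : hord v ((K *m t2) i j) 2.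
    by rewrite mxE; apply: hord_sum => // x _; apply: hord_oM.
  by rewrite scalemxE; move: (hordM Hv h2V h); apply: hord_le.
have oZ : omx v Z.
  by move=> i j; rewrite addmxE oppmxE hordB //; apply: omxM.
have GZ : inGLo v Z.
  apply/inGLoE; split=> //.
  (* Eliminating the [L_2]-components completely gives a block triangular matrix, so [Zf] has unit
     determinant; [Z] agrees with it modulo 2. *)
  pose Zf := X1 - X2 *m t.
  have oZf : omx v Zf.
    by move=> i j; rewrite addmxE oppmxE hordB //; apply: omxM.
  have uZf : unit_o v (\det Zf).
    have /inGLoE[_] := inGLoM Hv GW1 (inGLo_lblock ot).
    rewrite W1E mulmx_block !mulmx1 !mulmx0 !add0r !mulmxN Kt subrr det_ublock.
    by apply: unito_mulr; rewrite // hord_det.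
  apply: (unito_congr Hv uZf); apply: hord_det_congr => // i j.
  have -> : Z i j - Zf i j = (X2 *m t2) i j.
    by rewrite /Z /Zf /t2 mulmxBr !addmxE !oppmxE; ring.
  by rewrite mxE; apply: hord_sum => // x _; apply: hord_oM.
have colL j : col (lshift d j) W2 = col_mx (col j Z) (2%:R *: col j G).
  by rewrite W2E block_mxEh colKl col_col_mx GE linearZ.
have oc m (A : 'M[F]_(d, m)) j : omx v A -> omx v (col j A).
  by move=> oA x y; rewrite mxE.
have bC (y z : 'cV[F]_d) : omx v y -> omx v z -> hord v (bf C y z) (2 * k%:Z).
  move=> oy oz; have -> : bf C y z = qf C (y + z) - qf C y - qf C z by rewrite qfD; ring.
  by rewrite !hordB // qC // => i j; rewrite addmxE hordD.
have qZ j : qf B1 (col j Z) = qf B (col (lshift d j) W2) - 2%:R ^+ 2 * qf C (col j G).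
  by rewrite colL qf_block qfZ addrK.
have bZ i j : bf B1 (col i Z) (col j Z) = bf B (col (lshift d i) W2) (col (lshift d j) W2)
    - 2%:R ^+ 2 * bf C (col i G) (col j G).
  by rewrite !colL bf_block bfZl bfZr; ring.
have h4 : hord v (2%:R ^+ 2) 4 by move: (hordM Hv (hord2 Hv) (hord2 Hv)).
have dZ : dom v B1 Z (fun j => (minn (al j) k.+2)%:Z).
  case: dW2 => dq db; split=> [i|i j].
    rewrite qZ hordB //; first by apply: hord_le (dq _); rewrite -/(al i); lia.
    by move: (hordM Hv h4 (qC (oc _ _ i oG))); apply: hord_le; lia.
  rewrite bZ hordB //; first by apply: hord_le (db _ _); rewrite -/(al i) -/(al j); lia.
  by move: (hordM Hv h4 (bC _ _ (oc _ _ i oG) (oc _ _ j oG))); apply: hord_le; lia.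
pose es := [seq minn (al j) k.+2 | j <- enum 'I_n1].
have al_mono (i j : 'I_n1) : (i <= j)%N -> (al i <= al j)%N.
  rewrite leq_eqVlt => /orP[/eqP/val_inj ->//|/sl ij].
  by apply: a_mono => //; apply: ltnW.
(* [es <= a1] by maximality of [GK(B_1)], [a1 <= take n1 a] by [ext], and [take n1 a <= es] termwise
   because [s i >= i] on non-pivots. *)
have [E1 E2] : a1 = take n1 a /\ es = take n1 a.
  have sza1 : size a1 = n1 by have [] := isGK_dom symB1 gkB1.
  have szt : size (take n1 a) = n1 by rewrite size_takel // sa leq_addr.
  have szes : size es = n1 by rewrite size_map size_enum_ord.
  apply: lexle_squeeze; rewrite ?szt ?szes //.
  - apply: (isGK_lexle symB1 gkB1 GZ dZ).
    + exact: szes.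
    + apply/(sortedP 0%N) => i; rewrite size_map size_enum_ord => i1.
      have i0 : (i < n1)%N by exact: ltnW.
      rewrite (nth_map_enum_ord _ (Ordinal i0)) (nth_map_enum_ord _ (Ordinal i1)).
      by have := @al_mono (Ordinal i0) (Ordinal i1) (leqnSn i); lia.
    + by move=> i; rewrite nth_map_enum_ord.
  - rewrite -sza1; case: ext => b hb; apply: (@lexle_cat_take _ b).
    by case: gkB => _; apply.
  - move=> i i_n; rewrite nth_take // (nth_map_enum_ord _ (Ordinal i_n)).
    have s_ge m (hm : (m < n1)%N) : (m <= s (lshift d (Ordinal hm)))%N.
      elim: m hm => // m IH hm; have hm' : (m < n1)%N by exact: ltnW.
      by have := sl (Ordinal hm') (Ordinal hm) (ltnSn m); have := IH hm'; lia.
    have := a_mono _ _ (s_ge _ i_n) (ltn_ord _); have := an1 (Ordinal i_n).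
    by rewrite /al /=; lia.
have alE (j : 'I_n1) : minn (al j) k.+2 = nth 0%N a j.
  by rewrite -(nth_map_enum_ord (fun j => minn (al j) k.+2)) -/es E2 nth_take.
case: (boolP [forall j : 'I_n1, al j == nth 0%N a j]) => [/forallP good|].
  (* Without truncation the pivots carry the remaining exponents: both lists are sorted with the
     same multiset of entries. *)
  have beE i : be i = nth 0%N a (n1 + i).
    have eqs : [seq be i | i <- enum 'I_d] = [seq nth 0%N a (n1 + i) | i : 'I_d <- enum 'I_d].
      apply: (sorted_eq leq_trans anti_leq).
      - apply/(sortedP 0%N) => x; rewrite size_map size_enum_ord => x1.
        have x0 : (x < d)%N by exact: ltnW.
        rewrite (nth_map_enum_ord _ (Ordinal x0)) (nth_map_enum_ord _ (Ordinal x1)).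
        by apply: a_mono => //; apply/ltnW/sr.
      - apply/(sortedP 0%N) => x; rewrite size_map size_enum_ord => x1.
        have x0 : (x < d)%N by exact: ltnW.
        rewrite (nth_map_enum_ord (fun i : 'I_d => nth 0%N a (n1 + i)) (Ordinal x0)).
        rewrite (nth_map_enum_ord (fun i : 'I_d => nth 0%N a (n1 + i)) (Ordinal x1)) /=.
        by apply: a_mono; rewrite ?leq_add2l ?ltn_add2l.
      - apply/seq.permP => P; rewrite !count_map_enum_ord.
        apply: (@sum_perm_split _ _ s (fun x => nth 0%N a x) (fun x => P x)) => j.
        by congr (nat_of_bool (P _)); apply/eqP/good.
    by rewrite -nth_map_enum_ord eqs (nth_map_enum_ord (fun i : 'I_d => nth 0%N a (n1 + i))).
  exists W2; split=> //.
  - have as_ x : nth 0%N a (s x) = nth 0%N a x.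
      rewrite -[x]splitK; case: (split x) => y /=; first by apply/eqP/good.
      exact: beE.
    by case: dW2 => dq db; split=> [i|i j]; [rewrite -(as_ i) | rewrite -(as_ i) -(as_ j)].
  (* Here [al j <= be i] throughout, so every coefficient was subtracted. *)
  - rewrite W2E block_mxKdl (_ : t2 = 0) ?mulmx0 //; apply/matrixP => i j.
    rewrite /t2 addmxE !mxE beE (eqP (good j)) ifT ?subrr //.
    by have := an1 j; have := @a_mono n1 (n1 + i)%N (leq_addr _ _); have := ltn_ord i; lia.
case/forallPn => l bad.
have [al_l a_l] : (k.+2 < al l)%N /\ nth 0%N a l = k.+2.
  by have := alE l; have := an1 l; move: bad => /eqP; lia.
case: C_or => [|[bC2 [y0 oy0 qy0]]]; first by have := an1 l; lia.
(* Truncation does not affect values below [k + 2], so the non-pivots have as many of them as the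
   first [n1] entries of [a]; the last [d] entries have none, hence neither do the pivots. *)
have be_ge i : (k.+2 <= be i)%N.
  have : (\sum_(i < d) (be i < k.+2) = 0)%N.
    rewrite (@sum_perm_split _ _ s (fun x => nth 0%N a x) (fun x => (x < k.+2)%N)).
      apply: big1 => x _; apply/eqP; rewrite eqb0 -leqNgt -a_l.
      by apply: a_mono => //; apply: leq_trans (ltnW (ltn_ord l)) (leq_addr _ _).
    by move=> j; have := alE j; rewrite /al /= => <-; congr nat_of_bool; lia.
  by move/eqP; rewrite sum_nat_eq0 => /forallP/(_ i); rewrite eqb0 -leqNgt.
have dZa : dom v B1 Z (fun j => (nth 0%N a1 j)%:Z).
  have E (j : 'I_n1) : (nth 0%N a1 j)%:Z = (minn (al j) k.+2)%:Z by rewrite alE E1 nth_take.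
  by case: dZ => dq db; split=> [i|i j]; rewrite !E.
have a1E (j : 'I_n1) : nth 0%N a1 j = nth 0%N a j by rewrite E1 nth_take.
(* The exponent [al l] is at least [k + 3], which puts the projection [col l Z] in the radical at
   level [k + 2]. *)
have hbl j : hord v (bf B1 (col l Z) (col j Z)) (k%:Z + 3 + (nth 0%N a1 j)%:Z).
  rewrite bZ hordB //.
    case: dW2 => _ db; apply: hord_le (db _ _); rewrite -/(al l) -/(al j) a1E.
    by have := alE j; lia.
  have := hordM Hv h4 (bC2 _ _ (oc _ _ l oG) (oc _ _ j oG)); apply: hord_le.
  by rewrite a1E; have := an1 j; lia.
(* The second radical vector: a combination of pivots with [L_2]-component [y0] has value of order
   at least [k + 2], so its [L_1]-component [x] has value of exact order [k], like [y0]. *)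
pose cc := invmx K *m y0.
have occ : omx v cc by apply: omxM => //; apply: omx_inv.
pose x := X2 *m cc.
have wE : W2 *m col_mx 0 cc = col_mx x y0.
  by rewrite W2E mul_block_col !mulmx0 !add0r /cc mulKVmx // (inGLo_unitmx GK).
have hcc i : hord v ((col_mx 0 cc : 'cV_(n1 + d)) i 0) (k%:Z + 2 - (nth 0%N a (s i))%:Z).
  rewrite -[i]splitK; case: (split i) => i' /=; first by rewrite col_mxEu mxE hord0.
  by rewrite col_mxEd; apply: hord_le (occ i' 0); rewrite -/(be i'); have := be_ge i'; lia.
have qx : qf B1 x = qf B (W2 *m col_mx 0 cc) - qf C y0 by rewrite wE qf_block addrK.
have hqw : hord v (qf B (W2 *m col_mx 0 cc)) (2 * (k%:Z + 2)) by apply: qf_comb dW2 _.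
have hqx : hord v (qf B1 x) (2 * k%:Z).
  by rewrite qx hordB // ?qC //; apply: hord_le hqw; lia.
have hqx' : ~~ hord v (qf B1 x) (2 * k%:Z + 2).
  apply: contra qy0 => h; have -> : qf C y0 = qf B (W2 *m col_mx 0 cc) - qf B1 x.
    by rewrite qx; ring.
  by rewrite hordB //; apply: hord_le hqw; lia.
have hbx j : hord v (bf B1 x (col j Z)) (k%:Z + 2 + (nth 0%N a1 j)%:Z).
  have -> : bf B1 x (col j Z) =
      bf B (W2 *m col_mx 0 cc) (col (lshift d j) W2) - 2%:R * bf C y0 (col j G).
    by rewrite wE colL bf_block bfZr addrK.
  rewrite hordB //.
    apply: (@hord_le _ _ _ (k%:Z + 2 + (al j)%:Z)); first by rewrite a1E; have := alE j; lia.
    by apply: bf_comb hcc _ => // i; case: dW2 => _; apply.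
  have := hordM Hv (hord2 Hv) (bC2 _ _ oy0 (oc _ _ j oG)); apply: hord_le.
  by rewrite a1E; have := an1 j; lia.
case/negP: hqx'; apply: no_second_radical_vector symB1 gkB1 GZ dZa _ hbl _ hbx hqx.
  by rewrite a1E a_l.
exact: omxM.
Qed.

End Extension.
End Core.

(** * Passage to Gram matrices and optimality *)

Lemma ent_ord (R : nmodType) n (M : 'M[R]_n) (i j : 'I_n) : ent M i j = M i j.
Proof. by rewrite /ent !valK. Qed.

Lemma topleft_ulsubmx (R : nmodType) n1 d (M : 'M[R]_(n1 + d)) : topleft n1 M = ulsubmx M.
Proof. by apply/matrixP => i j; rewrite !mxE -(ent_ord M). Qed.

Section Main.
Variables (F : fieldType) (v : F -> int).
Hypothesis Hv : unram_ext_Q2 v.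

(** Forms equivalent under [GL_n(o)] admit the same exponent sequences, so [a] stays
    lexicographically greatest. *)
Lemma optimal_congr n (B U : 'M[F]_n) a : isGK v B a -> inGLo v U ->
  inS v (U^T *m B *m U) a -> optimal v (U^T *m B *m U).
Proof.
move=> [_ amax] GU inSa; exists a; split=> //; split.
  by exists 1%:M; split; [exact: inGLo1 | rewrite trmx1 mul1mx mulmx1].
move=> t [W [GW inSt]]; apply: amax; exists (U *m W); split; first exact: inGLoM.
by rewrite trmx_mul !mulmxA in inSt *.
Qed.

(** Stated for a variable [n] with an equation [e], so that substituting [n] removes the cast. *)
Lemma optimal_extension n n1 d (e : n = (n1 + d)%N) (B : 'M[F]_n) (B1 : 'M[F]_n1)
    (C : 'M[F]_d) a a1 k :
  castmx (e, e) B = block_mx B1 0 0 C ->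
  B1^T = B1 -> C^T = C -> (0 < d)%N ->
  (forall y : 'cV[F]_d, omx v y -> hord v (qf C y) (2 * k%:Z)) ->
  isGK v B a -> isGK v B1 a1 -> (exists b, SS v B (a1 ++ b)) ->
  (nth 0%N a n1 <= k.+2)%N ->
  ((nth 0%N a n1 < k.+2)%N \/
   ((forall y z : 'cV[F]_d, omx v y -> omx v z -> hord v (bf C y z) (2 * k%:Z + 2)) /\
    (exists2 y : 'cV[F]_d, omx v y & ~~ hord v (qf C y) (2 * k%:Z + 2)))) ->
  exists U : 'M[F]_n,
    [/\ inGLo v U,
        optimal v (U^T *m B *m U),
        (forall i j : 'I_n, (n1 <= i)%N -> (j < n1)%N -> U i j = 0),
        inGLo v (topleft n1 U) &
        optimal v (topleft n1 (U^T *m B *m U))].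
Proof.
subst n; rewrite castmx_id => -> symB1 symC d0 qC gkB gkB1 ext a_le C_or.
have symB : (block_mx B1 0 0 C)^T = block_mx B1 0 0 C.
  by rewrite tr_block_mx symB1 symC !trmx0.
have [U [GU dU U0 ta]] := extend_optimal_basis Hv symB1 symC d0 qC gkB gkB1 ext a_le C_or.
have [sa so _] := isGK_dom symB gkB.
have [sa1 so1 _] := isGK_dom symB1 gkB1.
have UE : U = block_mx (ulsubmx U) (ursubmx U) 0 (drsubmx U) by rewrite -U0 submxK.
case/inGLoE: (GU) => oU uU.
have GZ : inGLo v (ulsubmx U).
  have osub m p (f : 'I_m -> 'I_(n1 + d)) (g : 'I_p -> 'I_(n1 + d)) (A : 'M[F]_(m, p)) :
      (forall i j, A i j = U (f i) (g j)) -> omx v A.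
    by move=> h i j; rewrite h.
  have oul : omx v (ulsubmx U).
    by apply: (osub _ _ (@lshift n1 d) (@lshift n1 d)) => i j; rewrite !mxE.
  have odr : omx v (drsubmx U).
    by apply: (osub _ _ (@rshift n1 d) (@rshift n1 d)) => i j; rewrite !mxE.
  apply/inGLoE; split=> //; move: uU; rewrite {1}UE det_ublock.
  by apply: unito_mulr; rewrite // hord_det.
exists U; split=> //.
- by apply: optimal_congr gkB GU _; apply/inSE.
- move=> i j; rewrite -[i]splitK -[j]splitK.
  case: (split i) => i'; case: (split j) => j' /=; have := ltn_ord i'; have := ltn_ord j'; try lia.
  by rewrite UE block_mxEdl mxE.
- by rewrite topleft_ulsubmx.
rewrite topleft_ulsubmx.
(* [U] is block upper triangular, so this corner involves only [B1]. *)
have -> : ulsubmx (U^T *m block_mx B1 0 0 C *m U) = (ulsubmx U)^T *m B1 *m ulsubmx U.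
  rewrite {1 2}UE tr_block_mx !mulmx_block block_mxKul trmx0.
  by rewrite !mul0mx !mulmx0 !addr0.
apply: (optimal_congr gkB1 GZ); apply/inSE => //; split=> //.
have colL j : col (lshift d j) U = col_mx (col j (ulsubmx U)) 0.
  by rewrite {1}UE block_mxEh colKl col_col_mx col0.
have aE (j : 'I_n1) : nth 0%N a1 j = nth 0%N a (lshift d j) by rewrite -ta nth_take.
case: dU => dq db; split=> [i|i j]; rewrite !aE.
  by have := dq (lshift d i); rewrite colL qf_block qf0 addr0.
by have := db (lshift d i) (lshift d j); rewrite !colL bf_block bf0l addr0.
Qed.

Lemma hord_bilin d (C : 'M[F]_d) (y z : 'cV[F]_d) k : omx v y -> omx v z ->
  (forall i j, hord v (C i j) k) -> hord v ((y^T *m C *m z) 0 0) k.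
Proof.
move=> oy oz hC; rewrite mxE; apply: hord_sum => // j _; apply: hordMo => //.
by rewrite mxE; apply: hord_sum => // i _; apply: hord_oM => //; rewrite mxE.
Qed.

Lemma hord_bf_sym d (C : 'M[F]_d) (y z : 'cV[F]_d) k : C^T = C -> omx v y -> omx v z ->
  (forall i j, hord v (C i j) k) -> hord v (bf C y z) (k + 2).
Proof.
move=> symC oy oz hC; have -> : bf C y z = 2%:R * (y^T *m C *m z) 0 0.
  have E : (z^T *m C *m y) 0 0 = (y^T *m C *m z) 0 0.
    by rewrite -[z^T *m C *m y]trmxK [LHS]mxE !trmx_mul trmxK symC mulmxA.
  by rewrite /bf E; ring.
by rewrite addrC hordM // ?hord2 // hord_bilin.
Qed.

End Main.

(** * Splitting off the last block of [bmx] *)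

Section BlockMatrices.
Variable F : fieldType.

Lemma blkent_sym (b : blk F) i j : blkent b i j = blkent b j i.
Proof.
case: b => [k us|k x y z] /=; first by case: (eqVneq i j) => [->|]; rewrite // eq_sym => /negbTE ->.
by congr (_ * _); rewrite andbC; case: ifP => // _; rewrite andbC.
Qed.

Lemma bfun_sym (bs : seq (blk F)) i j : bfun bs i j = bfun bs j i.
Proof.
elim: bs i j => //= b bs IH i j.
by case: (i < bdeg b)%N; case: (j < bdeg b)%N; [exact: blkent_sym | | | exact: IH].
Qed.

Lemma bmx_sym (bs : seq (blk F)) : (bmx bs)^T = bmx bs.
Proof. by apply/matrixP => i j; rewrite !mxE bfun_sym. Qed.

Lemma bsdeg_rcons (bs : seq (blk F)) b : bsdeg (rcons bs b) = (bsdeg bs + bdeg b)%N.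
Proof. by rewrite /bsdeg map_rcons sumn_rcons. Qed.

(** [bfun] peels blocks from the front, whereas the last one has to be split off; the bounds keep
    the indices of [blkent] inside its block. *)
Lemma bfun_rcons (bs : seq (blk F)) b i j :
  (i < bsdeg bs + bdeg b)%N -> (j < bsdeg bs + bdeg b)%N ->
  bfun (rcons bs b) i j =
    if (i < bsdeg bs)%N then (if (j < bsdeg bs)%N then bfun bs i j else 0)
    else if (j < bsdeg bs)%N then 0 else blkent b (i - bsdeg bs) (j - bsdeg bs).
Proof.
elim: bs i j => [|c bs IH] i j /=; first by rewrite add0n !subn0 => -> ->.
rewrite /bsdeg /= -/(bsdeg bs) => hi hj.
case: (ltnP i (bdeg c)) => ic; case: (ltnP j (bdeg c)) => jc.
- by rewrite !ltn_addr.
- by rewrite (ltn_addr _ ic); case: ifP.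
- by rewrite (ltn_addr _ jc); case: ifP.
rewrite IH; [|lia..].
by rewrite !ltn_subLR // !subnDA.
Qed.

Definition blkmx (b : blk F) : 'M[F]_(bdeg b) := \matrix_(i, j) blkent b i j.

Lemma blkmx_sym b : (blkmx b)^T = blkmx b.
Proof. by apply/matrixP => i j; rewrite !mxE blkent_sym. Qed.

Lemma bmx_rcons (bs bs1 : seq (blk F)) b (e : bsdeg bs = (bsdeg bs1 + bdeg b)%N) :
  bs = rcons bs1 b ->
  castmx (e, e) (bmx bs) = block_mx (bmx bs1) 0 0 (blkmx b).
Proof.
move=> bsE; apply/matrixP => i j; rewrite castmxE mxE /= bsE bfun_rcons //.
rewrite -[i]splitK -[j]splitK.
case: (split i) => i'; case: (split j) => j' /=.
- by rewrite block_mxEul mxE !ltn_ord.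
- by rewrite block_mxEur mxE ltn_ord ltnNge leq_addr.
- by rewrite block_mxEdl mxE ltn_ord ltnNge leq_addr.
- by rewrite block_mxEdr mxE !ltnNge !leq_addr /= !addKn.
Qed.

End BlockMatrices.

(** * Orders of the values of a single block *)

Section BlockOrders.
Variables (F : fieldType) (v : F -> int).
Hypothesis Hv : unram_ext_Q2 v.

Lemma hord_exp2 k : hord v (2%:R ^+ k) (2 * k%:Z).
Proof.
elim: k => [|k IH]; first by rewrite hord1.
by rewrite exprS; move: (hordM Hv (hord2 Hv) IH); apply: hord_le; lia.
Qed.

Lemma hord_blkmx_Dg k us i j : wf_blk v (Dg k us) -> hord v (blkmx (Dg k us) i j) (2 * k%:Z).
Proof.
move=> [_ usP]; rewrite mxE /=; case: eqP => _; last by rewrite hord0.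
apply: hordMo => //; first exact: hord_exp2.
by have /usP/unitoE[] := mem_nth 0 (ltn_ord i).
Qed.

(** The first basis vector takes the value [2^k] times a unit. *)
Lemma blkmx_Dg_unit k us : wf_blk v (Dg k us) ->
  exists2 y, omx v y & ~~ hord v (qf (blkmx (Dg k us)) y) (2 * k%:Z + 2).
Proof.
move=> [us0 usP]; have sz : (0 < size us)%N by rewrite lt0n size_eq0.
exists (delta_mx (Ordinal sz) 0).
  by move=> i j; rewrite mxE; case: andP; rewrite ?hord0 ?hord1.
rewrite /qf trmx_delta -rowE -colE !mxE /=.
have [u0 vu] := usP _ (mem_nth 0 sz).
have e0 : (2%:R : F) ^+ k != 0 by rewrite expf_neq0 // (two_neq0 Hv).
have vk : v (2%:R ^+ k) = k%:Z.
  elim: (k) => [|p IH]; first by rewrite (ord_v1 Hv).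
  rewrite exprS (ord_vM Hv) ?expf_neq0 ?(two_neq0 Hv) // IH (ord_v2 Hv); lia.
by rewrite /hord mulf_eq0 (negbTE u0) (negbTE e0) /= (ord_vM Hv) // vk vu; lia.
Qed.

(** The off-diagonal entry [y / 2] occurs twice, so the value is [2^k] times an integral polynomial
    in the coordinates. *)
Lemma qf_blkmx_Nd k x y z (t : 'cV[F]_2) : wf_blk v (Nd k x y z) -> omx v t ->
  hord v (qf (blkmx (Nd k x y z)) t) (2 * k%:Z).
Proof.
move=> [hx [hy [hz _]]] ot; move: hx hy hz; rewrite /in_o !hordE mulr0 => hx hy hz.
have -> : qf (blkmx (Nd k x y z)) t = 2%:R ^+ k *
    (x * (t 0 0 * t 0 0) + y * (t 0 0 * t 1 0) + z * (t 1 0 * t 1 0)).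
  rewrite /qf !mxE !big_ord_recl big_ord0 !mxE !big_ord_recl !big_ord0 !mxE /=.
  have -> : lift ord0 ord0 = 1 :> 'I_2 by apply: val_inj.
  by field; rewrite (two_neq0 Hv).
apply: hordMo => //; first exact: hord_exp2.
by do 2?[apply: hordD => //]; do ?[apply: hordMo => //].
Qed.

End BlockOrders.

(** * Separating the last block and distinguishing its type *)

Theorem theorem2p1 (F : fieldType) (v : F -> int) (bs : seq (blk F))
    (a a1 : seq nat) :
  unram_ext_Q2 v ->
  (forall i, (i < size bs)%N -> wf_blk v (nth (blk0 F) bs i)) ->
  (0 < size bs)%N ->
  preoptimal v bs ->
  let r := size bs in
  let B := bmx bs in
  let B1 := bmx (take r.-1 bs) in
  let n1 := bsdeg (take r.-1 bs) in
  let m : int := if isD bs r then (kk bs r)%:Z else (kk bs r)%:Z - 2 in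
  isGK v B a ->
  isGK v B1 a1 ->
  (exists b : seq nat, SS v B (a1 ++ b)) ->
  (nth 0%N a n1)%:Z <= m + 2 ->
  exists U : 'M[F]_(bsdeg bs),
    [/\ inGLo v U,
        optimal v (U^T *m B *m U),
        (forall i j : 'I_(bsdeg bs), (n1 <= i)%N -> (j < n1)%N -> U i j = 0),
        inGLo v (topleft n1 U) &
        optimal v (topleft n1 (U^T *m B *m U))].
Proof.
move=> Hv wf r_gt0 _ r B B1 n1 m gkB gkB1 ext hm.
pose b := nth (blk0 F) bs r.-1.
have wfb : wf_blk v b by apply: wf; rewrite prednK.
have bsE : bs = rcons (take r.-1 bs) b.
  by rewrite -take_nth prednK // take_size.
have e : bsdeg bs = (n1 + bdeg b)%N by rewrite {1}bsE bsdeg_rcons.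
have castB : castmx (e, e) B = block_mx B1 0 0 (blkmx b) by apply: bmx_rcons.
have := @optimal_extension _ _ Hv _ _ _ e B B1 (blkmx b) a a1 (bk b) castB
  (bmx_sym _) (blkmx_sym b).
move: hm wfb; rewrite /m /isD /kk /bat -/b -/n1.
(* In the diagonal case [m + 2] is [k + 2]; otherwise it is [k], which gives the strict
   inequality. *)
case: b {m castB bsE} e => [k us|k x y z] e /= hm wfb; apply=> //; try lia.
- by rewrite lt0n size_eq0; case: wfb.
- by move=> y oy; apply: hord_bilin => // i j; apply: hord_blkmx_Dg.
- right; split; last exact: blkmx_Dg_unit.
  move=> y z oy oz; apply: (hord_bf_sym Hv (blkmx_sym (Dg k us)) oy oz) => i j.
  exact: hord_blkmx_Dg.
- by move=> t ot; apply: qf_blkmx_Nd.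
Qed.
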